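(* Let $G$ be a finite, simple, connected graph. There exists an evasive walk on $G$ if and only if $G$ is not a path, not a cycle, and not the graph $K_{1,3}$ (one vertex of degree $3$ joined to three vertices of degree $1$).
   Context: A walk on $G$ is an infinite sequence $R(1),R(2),\ldots$ of vertices of $G$ with $R(i)$ adjacent to $R(i+1)$ for every $i$. A random walk on $G$ is obtained by choosing $R(1)$ uniformly at random among the vertices and then choosing each $R(i+1)$ uniformly at random among the neighbours of $R(i)$. Given two walks $R,S$, place a token $T_R$ on $R(1)$ and a token $T_S$ on $S(1)$; a move advances exactly one of the tokens one step along its own walk (from $R(i)$ to $R(i+1)$, resp. $S(j)$ to $S(j+1)$). The pair $(R,S)$ is successful if there is an infinite sequence of moves in which each token is advanced infinitely often and the two tokens never occupy the same vertex at the same time (including at the start). A walk $S$ on $G$ is evasive if, for a random walk $R$ on $G$, the pair $(R,S)$ is successful with positive probability. *)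

(* Defs.v *)
From mathcomp Require Import all_boot all_order all_algebra.
From mathcomp Require Import all_classical all_reals all_analysis.

Set Implicit Arguments.
Unset Strict Implicit.
Unset Printing Implicit Defensive.

Import Order.TTheory GRing.Theory Num.Theory.

Local Open Scope classical_set_scope.
Local Open Scope ring_scope.

(* A finite simple graph is a symmetric irreflexive relation on a finType;    *)
(* walks are indexed from 0, so R(i) is [R i.-1].                             *)

Definition graph_iso (T U : finType) (e : rel T) (f : rel U) : Prop :=
  exists2 h : T -> U, bijective h & {mono h : x y / e x y >-> f x y}.

Definition path_rel (n : nat) : rel 'I_n :=
  fun i j => (j == i.+1 :> nat) || (i == j.+1 :> nat).

Definition cycle_rel (n : nat) : rel 'I_n :=
  fun i j => (j == i.+1 %% n :> nat)%N || (i == j.+1 %% n :> nat)%N.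

(* K_{1,3} on {0,1,2,3}, with centre 0. *)
Definition claw_rel : rel 'I_4 :=
  fun i j => (i == 0%N :> nat) != (j == 0%N :> nat).

(* The one-vertex graph is a path. *)
Definition is_path_graph (T : finType) (e : rel T) : Prop :=
  exists n, graph_iso e (@path_rel n).

Definition is_cycle_graph (T : finType) (e : rel T) : Prop :=
  exists2 n, (3 <= n)%N & graph_iso e (@cycle_rel n).

Definition is_claw_graph (T : finType) (e : rel T) : Prop :=
  graph_iso e claw_rel.

Definition is_walk (T : finType) (e : rel T) (R : nat -> T) : Prop :=
  forall i, e (R i) (R i.+1).

(* [m k] is true when move k advances T_R and false when it advances T_S;     *)
(* after k moves the tokens are at the terms of R and S whose indices count   *)
(* their respective advances so far.                                          *)
Definition successful (T : finType) (R S : nat -> T) : Prop :=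
  exists m : nat -> bool,
    [/\ forall n, exists2 k, (n <= k)%N & m k,
        forall n, exists2 k, (n <= k)%N & ~~ m k &
        forall k, R (\sum_(t < k) m t)%N <> S (\sum_(t < k) ~~ m t)%N].

(* The last clause says that, given the whole past X 0, ..., X n, the next    *)
(* vertex is uniform among the neighbours of X n.                             *)
Definition random_walk (K : realType) (T : finType) (e : rel T)
    (d : measure_display) (Omega : measurableType d)
    (P : probability Omega K) (X : nat -> Omega -> T) : Prop :=
  [/\ forall o, is_walk e (X^~ o),
      forall i x, measurable (X i @^-1` [set x]),
      forall x, P (X 0%N @^-1` [set x]) = (#|T|%:R^-1)%:E &
      forall n (v : nat -> T) (y : T), e (v n) y ->
        P [set o | (forall i, (i <= n)%N -> X i o = v i) /\ X n.+1 o = y] =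
        (P [set o | forall i, (i <= n)%N -> X i o = v i]
         * (#|e (v n)|%:R^-1)%:E)%E].

(* All random walks have the same law, so quantifying over their realizations *)
(* is harmless. The measurability clause is there because the value of a      *)
(* measure on a non-measurable set is meaningless.                            *)
Definition evasive (K : realType) (T : finType) (e : rel T)
    (S : nat -> T) : Prop :=
  is_walk e S /\
  forall (d : measure_display) (Omega : measurableType d)
         (P : probability Omega K) (X : nat -> Omega -> T),
    random_walk e P X ->
    let E := [set o | successful (X^~ o) S] in
    measurable E /\ (0 < P E)%E.

(* Main.v *)
(* A connected graph with no vertex of degree at least 3 is a path or a cycle. *)
(*                                                                            *)
(* Otherwise, unless the graph is the claw, it contains a claw or a triangle  *)
(* H missing some vertex. Inside H a token that knows the future of the other *)
(* one can always dodge it. Let S be a walk in H containing every finite walk *)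
(* of H infinitely often: whenever T_R is outside H, T_S moves freely, up to  *)
(* a stretch of S that dodges T_R until T_R next leaves H. So (R, S) is       *)
(* successful as soon as R starts at, and keeps returning to, a vertex        *)
(* outside H.                                                                 *)
(*                                                                            *)
(* Conversely, S fails almost surely if, whatever T_R has done so far, the    *)
(* probability that it will trap T_S is bounded below. On a path T_R only has *)
(* to visit both ends. On a cycle and on the claw (where the configuration    *)
(* space of two tokens is a cycle) the walks lift to the integers and the     *)
(* lifts stay at bounded distance. At a huge scale D, the lift of T_S reaches *)
(* D before -D or vice versa, while the lift of T_R, a martingale, goes the   *)
(* other way with probability close to 1/2.                                   *)

Require Import Defs.
From mathcomp Require Import all_boot all_order all_algebra.
From mathcomp Require Import all_classical all_reals all_analysis.
From mathcomp Require Import zify lra ring.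

Set Implicit Arguments.
Unset Strict Implicit.
Unset Printing Implicit Defensive.

Import Order.TTheory GRing.Theory Num.Theory.

(** Positive side. [path_or_cycle] and [claw_or_triangle] yield a claw or a triangle missing a
    vertex, a place where foresight suffices to survive ([claw_dodging], [triangle_dodging]). A walk
    repeating every finite walk of that place forever offers the required dodge again and again
    ([universal_walk]), so success only needs the random walk to be recurrent ([prob_avoid]).

    Negative side. Success keeps every history of R [feasible]. If feasibility is lost with
    probability at least a fixed c from every history, it is lost almost surely ([prob_keep0]).
    Visiting both ends achieves this on a path; on a cycle and on the claw, a gambler's ruin
    estimate for the lifted walk does ([keep_martingale], [keep_lifts]).

    The definition of [evasive] adds two burdens. A random walk has to be constructed, since
    otherwise evasiveness could hold vacuously ([random_walk_unit_step]). And success, a union over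
    uncountably many schedules, has to be measurable: for a universal walk it is rewritten through
    countably many conditions on finite prefixes ([criterion_successful], [successful_iff]). *)

(** * Connected graphs without vertices of degree three or more *)

Section SubcubicGraphs.
Context {T : finType} (e : rel T).
Hypothesis e_sym : symmetric e.
Hypothesis e_irr : irreflexive e.
Hypothesis e_connected : forall x y : T, connect e x y.

Lemma longest_path (x0 : T) : exists s : seq T,
  [/\ (0 < size s)%N, uniq s, sorted e s &
    forall s', uniq s' -> sorted e s' -> (size s' <= size s)%N].
Proof.
pose P k := [exists t : k.-tuple T, uniq t && sorted e t].
have P1 : exists k, P k by exists 1%N; apply/existsP; exists [tuple x0].
have Pb k : P k -> (k <= #|T|)%N.
  by case/existsP=> t /andP[ut _]; rewrite -(size_tuple t) -(card_uniqP ut) max_card.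
case: (ex_maxnP P1 Pb) => k /existsP[t /andP[ut st]] maxk.
exists t; rewrite size_tuple; split=> //.
  by apply: maxk; apply/existsP; exists [tuple x0].
by move=> s' us' ss'; apply: maxk; apply/existsP; exists (in_tuple s'); rewrite us'.
Qed.

Hypothesis deg2 : forall c a b d, e c a -> e c b -> e c d ->
  uniq [:: a; b; d] -> False.

(** A vertex off the path but adjacent to it would extend it at an end, or be a third neighbour of
    an inner vertex. So the path is closed under adjacency, and connectivity makes it spanning. *)
Lemma longest_path_spans (x0 : T) (s : seq T) : (0 < size s)%N -> uniq s ->
  sorted e s ->
  (forall s', uniq s' -> sorted e s' -> (size s' <= size s)%N) ->
  forall y, y \in s.
Proof.
move=> s0 us ss maxs.
have e_nth := sortedP x0 ss.
have cl : fingraph.closed e (mem s).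
  apply: (fingraph.intro_closed (fingraph.sym_connect_sym e_sym)) => x y exy xs.
  apply: contraT => yNs; case/(nthP x0): xs exy => i ilt <- exy.
  have [i0|i0] := posnP i.
    have := maxs (y :: s); rewrite /= yNs us ltnn; apply=> //.
    by move: ss s0 exy; rewrite i0; case: (s) => //= z s' -> _; rewrite e_sym => ->.
  have [ilast|ilast] := eqVneq i.+1 (size s).
    have := maxs (rcons s y); rewrite size_rcons ltnn rcons_uniq yNs us; apply=> //.
    apply/(sortedP x0) => j; rewrite size_rcons ltnS => jlt.
    rewrite !nth_rcons jlt; case: ltnP => j1; first exact: e_nth.
    have ej : j.+1 = size s by apply/eqP; rewrite eqn_leq jlt j1.
    by rewrite -ej eqxx; move: ej; rewrite -ilast => -[->].
  have i1 : (i.+1 < size s)%N by rewrite ltn_neqAle ilast.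
  exfalso; apply: (@deg2 (nth x0 s i) (nth x0 s i.-1) (nth x0 s i.+1) y) => //.
  - by rewrite e_sym -{2}(prednK i0); apply: e_nth; rewrite prednK.
  - exact: e_nth.
  have Ny j : (j < size s)%N -> nth x0 s j != y.
    by move=> jn; apply: contraNneq yNs => <-; apply: mem_nth.
  have i1n : (i.-1 < size s)%N by lia.
  rewrite /= !inE !negb_or !Ny // nth_uniq //; lia.
move=> y; rewrite -[_ \in s]/(y \in mem s).
rewrite -(fingraph.closed_connect cl (e_connected (nth x0 s 0) y)).
exact: mem_nth.
Qed.

(** Along a spanning path, any chord other than the one between the two ends gives an inner vertex a
    third neighbour. That last chord decides between a cycle and a path. *)
Lemma path_or_cycle (x0 : T) : is_path_graph e \/ is_cycle_graph e.
Proof.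
have [s [s0 us ss maxs]] := longest_path x0.
have ins := longest_path_spans x0 s0 us ss maxs.
have e_nth := sortedP x0 ss.
set n := size s in s0 maxs *.
have idx x : (index x s < n)%N by rewrite index_mem.
pose h x : 'I_n := Ordinal (idx x).
have hb : bijective h.
  exists (fun i : 'I_n => nth x0 s i) => [x|i]; first by rewrite /= nth_index.
  by apply: val_inj; rewrite /= index_uniq.
(* With two vertices the ends are already consecutive, so their edge must not count as a chord. *)
pose closing := (2 < n)%N && e (nth x0 s 0) (nth x0 s n.-1).
have adj i j : (i < j)%N -> (j < n)%N ->
  e (nth x0 s i) (nth x0 s j) = (j == i.+1) || [&& i == 0%N, j == n.-1 & closing].
  move=> ij jn; apply/idP/idP; last first.
    by case/orP=> [/eqP -> | /and3P[/eqP -> /eqP -> /andP[]] //]; apply: e_nth; lia.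
  move=> eij; have [//|jNi] := eqVneq j i.+1; rewrite /=.
  have nth_neq a b : (a < n)%N -> (b < n)%N -> a != b -> nth x0 s a != nth x0 s b.
    by move=> an bn; rewrite nth_uniq.
  have [i0|i0] := posnP i; last first.
    exfalso; apply: (@deg2 (nth x0 s i) (nth x0 s i.-1) (nth x0 s i.+1) (nth x0 s j)) => //.
    - by rewrite e_sym -{2}(prednK i0); apply: e_nth; lia.
    - by apply: e_nth; lia.
    by rewrite /= !inE !negb_or !nth_neq //; lia.
  have [j1|j1] := eqVneq j n.-1; last first.
    exfalso; apply: (@deg2 (nth x0 s j) (nth x0 s j.-1) (nth x0 s j.+1) (nth x0 s i)).
    - rewrite e_sym; have /prednK {2}<- : (0 < j)%N by lia.
      by apply: e_nth; lia.
    - by apply: e_nth; lia.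
    - by rewrite e_sym.
    by rewrite /= !inE !negb_or !nth_neq //; lia.
  by apply/and4P; split; [apply/eqP|apply/eqP|lia|rewrite -i0 -j1].
have adjh x y : e x y = [|| (index y s == (index x s).+1),
     (index x s == (index y s).+1) |
     closing && (((index x s == 0%N) && (index y s == n.-1))
     || ((index y s == 0%N) && (index x s == n.-1)))].
  have -> : e x y = e (nth x0 s (index x s)) (nth x0 s (index y s)) by rewrite !nth_index.
  have := idx x; have := idx y.
  move: (index x s) (index y s) => i j jn ijn; rewrite -/n.
  have cn : closing -> (2 < n)%N by case/andP.
  have [ij|ij|->] := ltngtP i j; last rewrite e_irr; first rewrite adj //; last 2 first.
  - by rewrite e_sym adj //; move: cn; generalize closing; clear -jn ijn ij; case => /=; lia.
  - by move: cn; generalize closing; clear -jn ijn; case => /=; lia.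
  by move: cn; generalize closing; clear -jn ijn ij; case => /=; lia.
case cl : closing; [right; exists n; first by case/andP: cl|left; exists n];
  exists h => // x y; rewrite adjh /cycle_rel /path_rel cl /= ?orbF //.
have n2 : (2 < n)%N by case/andP: cl.
have xn := idx x; have yn := idx y.
have modS k : (k < n)%N -> (k.+1 %% n)%N = if k == n.-1 then 0%N else k.+1.
  move=> kn; case: eqP => [->|kN]; first by rewrite prednK ?modnn //; lia.
  by rewrite modn_small //; lia.
by rewrite !modS //; do 2?case: ifP; lia.
Qed.

End SubcubicGraphs.

(* The claw and the triangle, missing the vertex [v], are grounds on which a  *)
(* token can dodge another one whose future it knows.                         *)
Lemma claw_or_triangle (T : finType) (e : rel T) (x0 : T) : symmetric e -> irreflexive e ->
  (forall x y : T, connect e x y) ->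
  ~ is_path_graph e -> ~ is_cycle_graph e -> ~ is_claw_graph e ->
  (exists c a b d v, [/\ e c a, e c b, e c d, uniq [:: a; b; d] & v \notin [:: c; a; b; d]])
  \/ (exists a b c v, [/\ e a b, e b c, e c a & v \notin [:: a; b; c]]).
Proof.
move=> e_sym e_irr conn NP NC Nclaw.
have [c [a [b [d [ca cb cd uabd]]]]] : exists c a b d,
    [/\ e c a, e c b, e c d & uniq [:: a; b; d]].
  apply: contrapT => H; have [] // := path_or_cycle e_sym e_irr conn _ x0.
  move=> c a b d ca cb cd u; apply: H; by exists c, a, b, d.
have Ne x y : e x y -> x != y by apply: contraTneq => ->; rewrite e_irr.
have [[v vN]|allin] := pselect (exists v, v \notin [:: c; a; b; d]).
  by left; exists c, a, b, d, v.
have all4 x : x \in [:: c; a; b; d].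
  by apply: contraT => xN; exfalso; apply: allin; exists x.
move: (uabd); rewrite /= !inE negb_or andbT => /andP[/andP[ab ad] bd].
have [eab|/negP eab] := boolP (e a b).
  right; exists c, a, b, d; split; rewrite // 1?e_sym // !inE !negb_or ![d == _]eq_sym.
  by rewrite (Ne _ _ cd) ad bd.
have [ead|/negP ead] := boolP (e a d).
  right; exists c, a, d, b; split; rewrite // 1?e_sym // !inE !negb_or ![b == _]eq_sym.
  by rewrite (Ne _ _ cb) ab eq_sym bd.
have [ebd|/negP ebd] := boolP (e b d).
  right; exists c, b, d, a; split; rewrite // 1?e_sym // !inE !negb_or.
  by rewrite eq_sym (Ne _ _ ca) ab ad.
(* No vertex is left out and no two leaves are adjacent: the graph is the claw. *)
exfalso; apply: Nclaw.
have idx x : (index x [:: c; a; b; d] < 4)%N by rewrite index_mem.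
have us : uniq [:: c; a; b; d].
  by rewrite cons_uniq uabd !inE !negb_or (Ne _ _ ca) (Ne _ _ cb) (Ne _ _ cd).
exists (fun x => Ordinal (idx x)).
  exists (fun i : 'I_4 => nth c [:: c; a; b; d] i) => [x|i]; first by rewrite nth_index.
  by apply: val_inj; exact: (@index_uniq T c i [:: c; a; b; d] (ltn_ord i) us).
have Nca := Ne _ _ ca; have Ncb := Ne _ _ cb; have Ncd := Ne _ _ cd.
have idx0 x : (index x [:: c; a; b; d] == 0%N) = (x == c).
  by rewrite /= [c == x]eq_sym; case: (x == c).
have eE x y : e x y = ((x == c) != (y == c)).
  have Nc z : z \in [:: a; b; d] -> z == c = false.
    by rewrite !inE => /or3P[] /eqP ->; rewrite eq_sym; apply: negbTE; apply: Ne.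
  have cE z : z \in [:: a; b; d] -> e c z by rewrite !inE => /or3P[] /eqP ->.
  have := all4 x; have := all4 y; rewrite !(in_cons c).
  case/predU1P=> [->|yl]; case/predU1P=> [->|xl]; rewrite ?eqxx ?e_irr ?Nc ?cE //.
    by rewrite e_sym cE.
  apply/negbTE/negP; move: xl yl; rewrite !inE.
  by case/or3P=> /eqP ->; case/or3P=> /eqP -> //; rewrite 1?e_irr // e_sym.
by move=> x y; rewrite eE -!idx0.
Qed.

Local Open Scope classical_set_scope.
Local Open Scope ring_scope.

(** * Survival probabilities *)

(* Histories are listed backwards: the current vertex comes first. *)
Fixpoint hist (T : Type) (R : nat -> T) n : seq T :=
  if n is m.+1 then R n :: hist R m else [:: R 0%N].

Section HistoryLemmas.
Context {T : Type}.
Implicit Types R V : nat -> T.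

Lemma size_hist R n : size (hist R n) = n.+1.
Proof. by elim: n => //= n ->. Qed.

Lemma hist_eq R V n : hist R n = hist V n <-> forall i, (i <= n)%N -> R i = V i.
Proof.
elim: n => [|n IHn] /=.
  by split=> [[RV] i|->//]; rewrite leqn0 => /eqP ->.
split=> [[RV /IHn IH] i|H].
  by rewrite leq_eqVlt => /predU1P[-> //|]; rewrite ltnS; apply: IH.
by rewrite H //; congr (_ :: _); apply/IHn => i /leqW; apply: H.
Qed.

End HistoryLemmas.

Section Survival.
Context {K : realType} {T : finType} (e : rel T).
Hypothesis deg_gt0 : forall x, (0 < #|e x|)%N.

Definition avg (w : seq T) (f : T -> K) : K :=
  if w is x :: _ then (#|e x|%:R)^-1 * \sum_(y in e x) f y else 0.

Lemma deg_inv_ge0 x : 0 <= (#|e x|%:R)^-1 :> K.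
Proof. by rewrite invr_ge0. Qed.

Lemma le_avg x h f g : (forall y, e x y -> f y <= g y) ->
  avg (x :: h) f <= avg (x :: h) g.
Proof.
by move=> fg; rewrite /avg ler_wpM2l ?deg_inv_ge0 //; apply: ler_sum => y /fg.
Qed.

Lemma eq_avg w f g : f =1 g -> avg w f = avg w g.
Proof. by move=> /funext ->. Qed.

Lemma avg_cst x h c : avg (x :: h) (fun=> c) = c.
Proof.
rewrite /avg sumr_const -[c *+ _]mulr_natl mulKf // pnatr_eq0 -lt0n.
exact: deg_gt0.
Qed.

Lemma avgZ w c f : avg w (fun y => c * f y) = c * avg w f.
Proof. by case: w => [|x h] /=; rewrite ?mulr0 // -mulr_sumr mulrCA. Qed.

Lemma avgD w f g : avg w (fun y => f y + g y) = avg w f + avg w g.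
Proof. by case: w => [|x h] /=; rewrite ?addr0 // big_split mulrDr. Qed.

(* Probability that the next [n] histories, and [w] itself, satisfy [A]. *)
Fixpoint keep (A : seq T -> Prop) n (w : seq T) : K :=
  if ~~ `[< A w >] then 0 else
  if n is m.+1 then avg w (fun y => keep A m (y :: w)) else 1.

Variable A : seq T -> Prop.

Lemma keepN n w : ~ A w -> keep A n w = 0.
Proof. by move=> /asboolPn Aw; case: n => [|n] /=; rewrite Aw. Qed.

Lemma keepS n w : A w -> keep A n.+1 w = avg w (fun y => keep A n (y :: w)).
Proof. by move=> /asboolP /= ->. Qed.

Lemma keep_ge0 n w : 0 <= keep A n w.
Proof.
elim: n w => [|n IHn] w /=; case: ifP => // _.
by case: w => //= x h; rewrite mulr_ge0 ?deg_inv_ge0 ?sumr_ge0.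
Qed.

Lemma keep_le1 n w : keep A n w <= 1.
Proof.
elim: n w => [|n IHn] w /=; case: ifP => // _.
case: w => [|x h] //; rewrite -[leRHS](avg_cst x h); exact: le_avg.
Qed.

Lemma keep_le m n w : (m <= n)%N -> keep A n w <= keep A m w.
Proof.
elim: m n w => [|m IHm] [|n] w //= mn; case: ifP => // _.
  by case: w => [|x h] //; rewrite -[leRHS](avg_cst x h); apply: le_avg => y _; exact: keep_le1.
by case: w => [|x h] //; apply: le_avg => y _; exact: IHm.
Qed.

(** Markov property. The horizon [m] may depend on the history reached after [n] steps, but there
    are only finitely many continuations, so a maximum serves them all. *)
Lemma keep_add c n w : 0 <= c -> (forall w', exists m, keep A m w' <= c) ->
  exists m, keep A (n + m) w <= c * keep A n w.
Proof.
move=> c0 Hc; elim: n w => [|n IHn] w.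
  case: (pselect (A w)) => Aw; last by exists 0%N; rewrite !keepN ?mulr0.
  have [m Hm] := Hc w; exists m.
  by rewrite add0n [keep A 0 w]/= (introT (asboolP _) Aw) mulr1.
case: (pselect (A w)) => Aw; last by exists 0%N; rewrite !keepN ?mulr0.
have [m Hm] := choice (fun y => IHn (y :: w)).
exists (\max_y m y)%N; rewrite addSn !keepS // -avgZ.
case: w {IHn} Aw m Hm => [|x h] Aw m Hm //.
apply: le_avg => y _; apply: le_trans (Hm y).
by apply: keep_le; rewrite leq_add2l leq_bigmax.
Qed.

Lemma keep_expn d k w : 0 <= d <= 1 -> (forall w', exists m, keep A m w' <= 1 - d) ->
  exists m, keep A m w <= (1 - d) ^+ k.
Proof.
move=> /andP[d0 d1] Hd; elim: k w => [|k IHk] w.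
  by exists 0%N; rewrite expr0 keep_le1.
have [n Hn] := Hd w.
have [|m Hm] := @keep_add ((1 - d) ^+ k) n w _ IHk; first by rewrite exprn_ge0 // subr_ge0.
exists (n + m)%N; apply: (le_trans Hm); rewrite exprSr ler_wpM2l //.
by rewrite exprn_ge0 // subr_ge0.
Qed.

Lemma keep_to0 d eps w : 0 < d -> (forall w', exists m, keep A m w' <= 1 - d) ->
  0 < eps -> exists m, keep A m w <= eps.
Proof.
move=> d0 Hd eps0.
have d1 : d <= 1.
  by have [m Hm] := Hd w; have := keep_ge0 m w; lra.
have : `|1 - d| < 1 by rewrite ger0_norm ?subr_ge0 //; lra.
move=> /cvg_expr /cvgrPdist_le /(_ _ eps0) [k _ /(_ k)] /= Hk.
have [m Hm] := @keep_expn d k w ltac:(lra) Hd; exists m; apply: (le_trans Hm).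
have := Hk (leqnn k); rewrite sub0r normrN ger0_norm //.
by rewrite exprn_ge0 // subr_ge0.
Qed.

End Survival.

Arguments avg : simpl never.

Lemma le_prob_bigU {K : realType} {d : measure_display} {Omega : measurableType d}
    (P : probability Omega K) (I : finType) (E : set Omega) (F : I -> set Omega) (Q : pred I) :
  measurable E -> (forall i, measurable (F i)) ->
  (forall o, E o -> exists2 i, Q i & F i o) -> (P E <= \sum_(i | Q i) P (F i))%E.
Proof.
move=> mE mF EF.
have mU (s : seq I) : measurable (\big[setU/set0]_(i <- s | Q i) F i).
  by apply: bigsetU_measurable.
apply: (@le_trans _ _ (P (\big[setU/set0]_(i | Q i) F i))).
  apply: le_measure; rewrite ?inE //.
  by move=> o /EF[i Qi Fi]; rewrite -[X in X o](@bigcup_pred _ _ Q); exists i.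
elim: (index_enum I) => [|i s IHs]; first by rewrite !big_nil measure0.
rewrite !big_cons; case: ifP => // Qi.
by apply: (le_trans (measureU2 P (mF i) (mU s))); rewrite leeD2l.
Qed.

Section NullEvents.
Context {K : realType} {T : finType} (e : rel T).
Hypothesis deg_gt0 : forall x, (0 < #|e x|)%N.
Context {d : measure_display} {Omega : measurableType d}.
Variables (P : probability Omega K) (X : nat -> Omega -> T).
Hypothesis rwX : random_walk e P X.

Lemma measurable_hist m w : measurable [set o | hist (X^~ o) m = w].
Proof.
case: rwX => _ mX _ _.
elim: m w => [|m IHm] [|y h] /=.
- rewrite (_ : mkset _ = set0) //; by apply/seteqP; split=> o.
- case: h => [|z h].
    rewrite (_ : mkset _ = X 0%N @^-1` [set y]) //.
    by apply/seteqP; split=> o /= => [[]|->].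
  rewrite (_ : mkset _ = set0) //; by apply/seteqP; split=> o.
- rewrite (_ : mkset _ = set0) //; by apply/seteqP; split=> o.
rewrite (_ : mkset _ = X m.+1 @^-1` [set y] `&` [set o | hist (X^~ o) m = h]).
  exact: measurableI.
by apply/seteqP; split=> o /= [-> ->].
Qed.

Lemma prob_histS m x y h : e x y ->
  P [set o | hist (X^~ o) m.+1 = [:: y, x & h]] =
  (P [set o | hist (X^~ o) m = x :: h] * (#|e x|%:R^-1)%:E)%E.
Proof.
move=> exy; case: rwX => _ _ _ step.
(* The law of the walk is stated for sequences, not for histories; an outcome with this history
   supplies the sequence. If there is none, both sides vanish. *)
have [[w0 ho0]|no] := pselect (exists o, hist (X^~ o) m = x :: h); last first.
  rewrite [X in P X](_ : _ = set0) ?[X in (P X * _)%E](_ : _ = set0) ?measure0 ?mul0e //.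
  - by apply/seteqP; split=> o //= ho; apply: no; exists o.
  - by apply/seteqP; split=> o //= [_ ho]; apply: no; exists o.
have vx : X m w0 = x by move: ho0; case: (m) => [|k] /= [->].
have := step m (X^~ w0) y; rewrite vx => /(_ exy).
have E o : hist (X^~ o) m = x :: h <-> (forall i, (i <= m)%N -> X i o = X i w0).
  by rewrite -ho0; apply: hist_eq.
rewrite (_ : [set o | hist (X^~ o) m = x :: h] =
  [set o | forall i, (i <= m)%N -> X i o = X i w0]); last first.
  by apply/seteqP; split=> o /= /E.
move=> <-; congr (P _); apply/seteqP; split=> o /=.
  by move=> [-> /E].
by move=> [/E -> ->].
Qed.

Variables (A : seq T -> Prop) (E : set Omega).
Hypothesis mE : measurable E.
Hypothesis EA : forall o, E o -> forall n, A (hist (X^~ o) n).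

(** This ties the recursion [keep] to the actual walk: one step splits the event over the
    neighbours, and [prob_histS] gives each of them the weight used in [avg]. *)
Lemma prob_keep n m w : (P (E `&` [set o | hist (X^~ o) m = w]) <=
  P [set o | hist (X^~ o) m = w] * (keep e A n w)%:E)%E.
Proof.
elim: n m w => [|n IHn] m w.
  case: (pselect (A w)) => Aw; last first.
    rewrite (_ : _ `&` _ = set0) ?measure0 ?keepN ?mule0 //.
    by apply/seteqP; split=> o //= [Eo ho]; apply: Aw; rewrite -ho; apply: EA.
  rewrite /= (introT (asboolP _) Aw) /= mule1.
  apply: le_measure; rewrite ?inE; last exact: subIsetr.
    apply: measurableI => //; exact: measurable_hist.
  exact: measurable_hist.
case: (pselect (A w)) => Aw; last first.
  rewrite (_ : _ `&` _ = set0) ?measure0 ?keepN ?mule0 //.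
  by apply/seteqP; split=> o //= [Eo ho]; apply: Aw; rewrite -ho; apply: EA.
rewrite keepS //; case: w Aw => [|x h] Aw.
  rewrite (_ : _ `&` _ = set0) ?measure0 ?mule0 //.
  by apply/seteqP; split=> o //= [_]; case: (m).
have mh k w : measurable (E `&` [set o | hist (X^~ o) k = w]).
  apply: measurableI => //; exact: measurable_hist.
apply: (@le_trans _ _ (\sum_(y in e x) P (E `&` [set o | hist (X^~ o) m.+1 = y :: x :: h]))%E).
  apply: (@le_prob_bigU K d Omega P T _
    (fun y => E `&` [set o | hist (X^~ o) m.+1 = y :: x :: h]) [in e x]) => //.
  move=> o [Eo /= ho]; exists (X m.+1 o); last by rewrite ho.
  have [walk _ _ _] := rwX.
  have -> : x = X m o by move: ho; case: (m) => [|k] /= [->].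
  exact: walk.
apply: (@le_trans _ _ (\sum_(y in e x) (P [set o | hist (X^~ o) m = x :: h] *
     ((#|e x|%:R^-1)%:E * (keep e A n [:: y, x & h])%:E)))%E).
  by apply: lee_sum => y exy; rewrite muleA -(prob_histS m h exy); exact: IHn.
rewrite -ge0_sume_distrr; last first.
  by move=> y _; rewrite mule_ge0 // lee_fin ?keep_ge0 ?deg_inv_ge0.
rewrite /avg mulr_sumr -sumEFin.
by rewrite le_eqVlt; apply/orP; left; apply/eqP; congr (_ * _)%E; apply: eq_bigr => y _; rewrite EFinM.
Qed.

Lemma prob_keep0 (c : K) : 0 < c -> (forall w, exists n, keep e A n w <= 1 - c) ->
  P E = 0%E.
Proof.
move=> c0 Hc; apply/eqP; rewrite eq_le measure_ge0 andbT.
apply/lee_addgt0Pr => eps eps0; rewrite add0e.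
pose N : K := (#|T|.+1)%:R.
have N0 : 0 < N by rewrite ltr0n.
have eN0 : 0 < eps / N by rewrite divr_gt0.
have [n Hn] := choice (fun x => keep_to0 deg_gt0 [:: x] c0 Hc eN0).
pose m := (\max_x n x)%N.
have mh w : measurable (E `&` [set o | hist (X^~ o) 0 = w]).
  apply: measurableI => //; exact: measurable_hist.
apply: (@le_trans _ _ (\sum_(x : T) P (E `&` [set o | hist (X^~ o) 0 = [:: x]]))%E).
  apply: (@le_prob_bigU K d Omega P T _
    (fun x => E `&` [set o | hist (X^~ o) 0 = [:: x]]) xpredT) => //.
  by move=> o Eo; exists (X 0%N o).
apply: (@le_trans _ _ (\sum_(x : T) (eps / N)%:E)%E).
  apply: lee_sum => x _; apply: (le_trans (prob_keep m 0 [:: x])).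
  rewrite -[leRHS]mul1e lee_pmul ?lee_fin ?keep_ge0 //.
    by apply: probability_le1; exact: measurable_hist.
  apply: le_trans (Hn x); apply: keep_le => //; exact: leq_bigmax.
rewrite sumEFin lee_fin sumr_const -[_ *+ _]mulr_natl mulrCA ger_pMr //.
by rewrite ler_pdivrMr // mul1r ler_nat.
Qed.

End NullEvents.

(** * Lattice paths of the two tokens *)

Section Escape.
Context {K : realType} {T : finType} (e : rel T).
Hypothesis deg_gt0 : forall x, (0 < #|e x|)%N.
Variable A : seq T -> Prop.

Lemma keep_escape_path x h q : path e x q -> ~ A (catrev q (x :: h)) ->
  keep (K := K) e A (size q) (x :: h) <= 1 - (#|T|%:R)^-1 ^+ size q.
Proof.
elim: q x h => [|y q IHq] x h /=.
  by move=> _ /asboolPn ->; rewrite expr0 subrr.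
case/andP=> exy pq NA; case: ifP => [_|_].
  rewrite subr_ge0; apply: exprn_ile1; rewrite ?invr_ge0 //.
  rewrite invf_le1 ?ler1n ?ltr0n; by apply/card_gt0P; exists x.
have := IHq y (x :: h) pq NA; set t := _ ^+ _ => IH.
have t0 : 0 <= t by rewrite exprn_ge0 // invr_ge0.
(* Only the branch through [y] is known to lose mass; on the other neighbours survival is bounded by
   1. *)
apply: (@le_trans _ _ (avg e (x :: h) (fun z => 1 + (- t) * (z == y)%:R))).
  apply: le_avg => // z _; have [->|_] := eqVneq z y; first by rewrite mulr1.
  by rewrite mulr0 addr0 keep_le1.
rewrite avgD avgZ avg_cst // lerD2l mulNr lerN2 exprS -/t mulrC ler_wpM2l //.
rewrite /avg (bigD1 y) //= eqxx big1 => [|z /andP[_ /negbTE->] //].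
rewrite addr0 mulr1 lef_pV2 ?posrE ?ltr0n ?ler_nat ?max_card //.
by apply/card_gt0P; exists x.
Qed.

Lemma keep_escape L : (0 < L)%N ->
  (forall x h, A (x :: h) -> exists q,
    [/\ path e x q, (size q <= L)%N & ~ A (catrev q (x :: h))]) ->
  forall w, keep (K := K) e A L w <= 1 - (#|T|%:R)^-1 ^+ L.
Proof.
move=> L0 esc w.
have V0 : 0 <= (#|T|%:R)^-1 :> K by rewrite invr_ge0.
have V1 : (#|T|%:R)^-1 <= 1 :> K.
  have [->|T0] := posnP #|T|; first by rewrite invr0.
  by rewrite invf_le1 ?ler1n ?ltr0n.
have V1' k : (#|T|%:R)^-1 ^+ k <= 1 :> K by apply: exprn_ile1.
case: (pselect (A w)) => Aw; last by rewrite keepN // subr_ge0.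
case: w Aw => [|x h] Aw.
  by case: L L0 {esc} => // L _; rewrite keepS // subr_ge0.
have [q [pq sq NA]] := esc x h Aw.
apply: (le_trans (keep_le deg_gt0 A _ sq)); apply: (le_trans (keep_escape_path pq NA)).
rewrite lerD2l lerN2; exact: ler_wiXn2l.
Qed.

End Escape.

Section Reach.
Context {T : Type} (R S : nat -> T).

(* [reach i j]: the tokens can be brought to [R i] and [S j]. *)
Inductive reach : nat -> nat -> Prop :=
| reach0 : R 0%N <> S 0%N -> reach 0 0
| reachR i j : reach i j -> R i.+1 <> S j -> reach i.+1 j
| reachS i j : reach i j -> R i <> S j.+1 -> reach i j.+1.

Lemma reach_neq i j : reach i j -> R i <> S j.
Proof. by case. Qed.

(** A schedule is a monotone lattice path, so it has crossed every earlier column. *)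
Lemma reach_leR i j : reach i j -> forall i', (i' <= i)%N ->
  exists2 j', (j' <= j)%N & reach i' j'.
Proof.
elim=> [H|{}i {}j r IH H|{}i {}j r IH H] i'.
- by rewrite leqn0 => /eqP ->; exists 0%N => //; apply: reach0.
- by rewrite leq_eqVlt => /predU1P[-> | /IH//]; exists j => //; apply: reachR.
- by move=> /IH[j' /leqW]; exists j'.
Qed.

Lemma reach_leS i j : reach i j -> forall j', (j' <= j)%N ->
  exists2 i', (i' <= i)%N & reach i' j'.
Proof.
elim=> [H|{}i {}j r IH H|{}i {}j r IH H] j'.
- by rewrite leqn0 => /eqP ->; exists 0%N => //; apply: reach0.
- by move=> /IH[i' /leqW]; exists i'.
- by rewrite leq_eqVlt => /predU1P[-> | /IH//]; exists i => //; apply: reachS.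
Qed.

End Reach.

Lemma next_move (m : nat -> bool) k : (forall n, exists2 k, (n <= k)%N & m k) ->
  exists2 l, m l & (\sum_(t < l) m t = \sum_(t < k) m t)%N.
Proof.
move=> inf.
have ex : exists l, (k <= l)%N && m l by have [l kl ml] := inf k; exists l; rewrite kl.
have [l /andP[kl ml] minl] := ex_minnP ex; exists l => //.
rewrite -!(big_mkord xpredT (fun t => nat_of_bool (m t))) (big_cat_nat (leq0n k) kl) /=.
rewrite -[RHS]addn0; congr (_ + _)%N; rewrite big_nat_cond big1 // => t.
rewrite andbT => /andP[kt tl]; case E: (m t) => //.
by have := minl t; rewrite kt E leqNgt tl => /(_ isT).
Qed.

(** The time [k] is the one at which index [n] is left, not just any time spent there: schedules are
    cut at such moves. *)
Lemma partial_sum_onto (m : nat -> bool) :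
  (forall n, exists2 k, (n <= k)%N & m k) ->
  forall n, exists2 k, m k & (\sum_(t < k) m t)%N = n.
Proof.
move=> inf; elim=> [|n [k mk Hk]].
  by have [k mk Hk] := next_move 0 inf; exists k; rewrite // Hk big_ord0.
have [l ml Hl] := next_move k.+1 inf; exists l => //.
by rewrite Hl big_ord_recr /= mk Hk addn1.
Qed.

Section SuccessfulReach.
Context {T : finType} (R S : nat -> T).

Lemma reach_moves (m : nat -> bool) :
  (forall k, R (\sum_(t < k) m t)%N <> S (\sum_(t < k) ~~ m t)%N) ->
  forall k, reach R S (\sum_(t < k) m t) (\sum_(t < k) ~~ m t).
Proof.
move=> ok; elim=> [|k IHk].
  by have := ok 0%N; rewrite !big_ord0; apply: reach0.
have := ok k.+1; rewrite !big_ord_recr /=.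
case: (m k); rewrite /= ?addn0 ?addn1 => H; [exact: reachR | exact: reachS].
Qed.

Lemma successful_reachR : successful R S -> forall n, exists j, reach R S n j.
Proof.
case=> m [infR _ ok] n; have [k _ <-] := partial_sum_onto infR n.
by exists (\sum_(t < k) ~~ m t)%N; apply: reach_moves.
Qed.

End SuccessfulReach.

(* The histories of walks that a token following [S] can survive. *)
Definition feasible (T : finType) (e : rel T) (S : nat -> T) (w : seq T) : Prop :=
  exists R n j, [/\ is_walk e R, hist R n = w & reach R S n j].

Lemma mem_hist (T : eqType) (R : nat -> T) n z :
  z \in hist R n -> exists2 i, (i <= n)%N & R i = z.
Proof.
elim: n => [|n IHn] /=; first by rewrite inE => /eqP ->; exists 0%N.
rewrite inE => /predU1P[-> | /IHn[i /leqW]]; first by exists n.+1.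
by exists i.
Qed.

Section PathGraph.
Context {K : realType} {T : finType} (e : rel T) (n : nat) (h : T -> 'I_n).
Hypothesis h_inj : injective h.
Hypothesis he : {mono h : x y / e x y >-> path_rel x y}.
Variable S : nat -> T.
Hypothesis wS : is_walk e S.

Lemma reach_side R i j : is_walk e R -> reach R S i j ->
  (h (R i) < h (S j))%N = (h (R 0%N) < h (S 0%N))%N.
Proof.
move=> wR.
have step (V : nat -> T) k : is_walk e V ->
  (h (V k.+1) = (h (V k)).+1 :> nat \/ h (V k) = (h (V k.+1)).+1 :> nat).
  by move=> /(_ k); rewrite -he => /orP[/eqP|/eqP]; [left|right].
have neq x y : x <> y -> h x <> h y :> nat by move=> xy /val_inj /h_inj.
elim=> // {}i {}j r <- /neq; have := neq _ _ (reach_neq r).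
  by have := step R i wR; lia.
by have := step S j wS; lia.
Qed.

(* Tokens on a path never change sides, so T_R dies if it visits both ends. *)
Lemma path_not_feasible w a b :
  h a = 0%N :> nat -> h b = n.-1 :> nat -> a \in w -> b \in w ->
  ~ feasible e S w.
Proof.
move=> ha hb aw bw [R [k [j [wR hR r]]]].
have neq x y : x <> y -> h x <> h y :> nat by move=> xy /val_inj /h_inj.
move: aw bw; rewrite -hR => /mem_hist[i ik Ria] /mem_hist[i' ik' Rib].
have [j1 _ r1] := reach_leR r ik; have [j2 _ r2] := reach_leR r ik'.
have := reach_side wR r1; rewrite -(reach_side wR r2).
have := neq _ _ (reach_neq r1); have := neq _ _ (reach_neq r2).
rewrite Ria Rib ha hb; have := ltn_ord (h (S j1)); have := ltn_ord (h (S j2)).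
lia.
Qed.

End PathGraph.

Section Connected.
Context {T : finType} (e : rel T).
Hypothesis e_sym : symmetric e.
Hypothesis e_connected : forall x y : T, connect e x y.

Lemma connecting_path x y : exists q,
  [/\ path e x q, last x q = y & (size q <= #|T|)%N].
Proof.
have /connectP[p ep ->] := e_connected x y.
case/shortenP: ep => q eq uq _; exists q; split=> //.
by have := max_card (mem (x :: q)); rewrite (card_uniqP uq) => /ltnW.
Qed.

(** Arbitrary steps come before the path to [v], so that the visit falls after a prescribed time. *)
Lemma long_path x v m : (forall x, (0 < #|e x|)%N) -> exists q,
  [/\ path e x q, last x q = v & (m <= size q <= m + #|T|)%N].
Proof.
move=> deg_gt0; elim: m x => [|m IHm] x.
  by have [q [? ? ?]] := connecting_path x v; exists q.
have /card_gt0P[y xy] := deg_gt0 x; have [q [pq lq sq]] := IHm y.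
by exists (y :: q); split=> //=; rewrite [e x y]xy.
Qed.

End Connected.

(** * Integer lifts and the gambler's ruin *)

(* [M] lifts T_R to the integers: it is a martingale along a random walk      *)
(* (with [b] correcting the variance on steps that do not move the lift), and *)
(* the lift of T_R stays within [N] of the lift [L] of T_S.                   *)
Record lifts {K : realType} {T : finType} (e : rel T) (S : nat -> T)
    (N : nat) (M : seq T -> int) (b : seq T -> K) (L : nat -> int) : Prop := Lifts {
  lift_start : forall x, `|M [:: x]| <= N%:Z;
  lift_step : forall x y h, e x y -> `|M [:: y, x & h] - M (x :: h)| <= 1;
  lift_mean : forall x h, avg e (x :: h) (fun y => (M [:: y, x & h])%:~R) = (M (x :: h))%:~R :> K;
  lift_corr : forall w, 0 <= b w <= 1;
  lift_drift : forall x h, 3 * (M (x :: h))%:~R ^+ 2 + b (x :: h) + 1 <=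
    avg e (x :: h) (fun y => 3 * (M [:: y, x & h])%:~R ^+ 2 + b [:: y, x & h]);
  lift_track : forall R i j, is_walk e R -> reach R S i j ->
    `|M (hist R i) - L j| < N%:Z }.

Lemma lifts_opp {K : realType} {T : finType} (e : rel T) S N M (b : seq T -> K) L :
  lifts e S N M b L -> lifts e S N (fun w => - M w) b (fun j => - L j).
Proof.
case=> H1 H2 H3 H4 H5 H6; split=> //.
- by move=> x; rewrite normrN.
- by move=> x y h exy; rewrite -opprD normrN H2.
- move=> x h; rewrite rmorphN /= -H3 -mulN1r -avgZ; apply: eq_avg => y.
  by rewrite rmorphN mulN1r.
- move=> x h; rewrite rmorphN sqrrN; apply: (le_trans (H5 x h)).
  rewrite le_eqVlt; apply/orP; left; apply/eqP; apply: eq_avg => y.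
  by rewrite rmorphN sqrrN.
- by move=> R i j wR r; rewrite -opprD normrN H6.
Qed.

Lemma drop_hist T (R : nat -> T) n k : (k <= n)%N -> drop k (hist R n) = hist R (n - k).
Proof.
elim: n k => [|n IHn] [|k] //= kn; exact: IHn.
Qed.

Section Martingale.
Context {K : realType} {T : finType} (e : rel T) (S : nat -> T).
Hypothesis deg_gt0 : forall x, (0 < #|e x|)%N.
Context {N : nat} {M : seq T -> int} {b : seq T -> K} {L : nat -> int}.
Hypothesis HL : lifts e S N M b L.

Lemma lift_bound R n : is_walk e R -> `|M (hist R n)| <= (n + N)%:Z.
Proof.
move=> wR; elim: n => [|n IHn]; first by have := lift_start HL (R 0%N).
have /= : `|M (hist R n.+1) - M (hist R n)| <= 1.
  rewrite /=; case: n {IHn} => [|n] /=; exact: (lift_step HL _ (wR _)).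
lia.
Qed.

Variable D : nat.
Hypothesis ND : (N < D)%N.
Hypothesis up_first : forall j, L j <= - D%:Z -> exists2 j', (j' <= j)%N & D%:Z <= L j'.

(** The lift of T_S must by then be below -D, hence was at D or above in an earlier row. When T_S
    was there, the lift of T_R exceeded D - N, which the history excludes. *)
Lemma not_feasible_down w : M w <= - (D + N)%:Z ->
  (forall k, (0 < k < size w)%N -> M (drop k w) <= (D - N)%:Z) ->
  ~ feasible e S w.
Proof.
move=> Mw Mdrop [R [n [j [wR hR r]]]].
have t1 := lift_track HL wR r; rewrite hR in t1.
have [|j' jj' Lj'] := up_first (j := j); first by lia.
have [i' ii' r'] := reach_leS r jj'; have t2 := lift_track HL wR r'.
have [E|ne] := eqVneq i' n; first by move: t2; rewrite E hR; lia.
have := Mdrop (n - i')%N; rewrite -hR size_hist drop_hist ?leq_subr // subKn //.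
by lia.
Qed.

Let lin (z : int) : K := (z%:~R + D%:R + N%:R) / (2 * D%:R).
Let quad w : K := 3 * ((M w)%:~R + D%:R + N%:R) * (D%:R - N%:R - (M w)%:~R) + 1 - b w.

(* Optional stopping: [lin] bounds the probability of leaving [-D-N, D-N]     *)
(* upwards, and [quad] the expected time to leave.                            *)
Lemma keep_martingale n w : w <> [::] ->
  - (D + N)%:Z <= M w <= (D - N)%:Z ->
  (forall k, (0 < k < size w)%N -> M (drop k w) <= (D - N)%:Z) ->
  n%:R * keep e (feasible e S) n w <= n%:R * lin (M w) + quad w.
Proof.
have D0 : 0 < D%:R :> K by rewrite ltr0n (leq_ltn_trans _ ND).
have DN : (D - N)%:R = D%:R - N%:R :> K by rewrite natrB // ltnW.
elim: n w => [|n IHn] w w0 /andP[Ml Mu] Mdrop;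
  have Ml' : - (D%:R + N%:R) <= (M w)%:~R :> K
    by move: Ml; rewrite -(ler_int K) rmorphN /= -pmulrn natrD.
all: have Mu' : (M w)%:~R <= D%:R - N%:R :> K
    by move: Mu; rewrite -(ler_int K) -pmulrn DN.
all: have /andP[b0 b1] := lift_corr HL w.
all: have prod0 : 0 <= ((M w)%:~R + D%:R + N%:R) * (D%:R - N%:R - (M w)%:~R) :> K
  by apply: mulr_ge0; lra.
all: have quad0 : 0 <= quad w by rewrite /quad; lra.
  by rewrite !mul0r add0r.
have lin0 : 0 <= lin (M w) by rewrite /lin divr_ge0 //; lra.
have n0 : 0 <= n.+1%:R * lin (M w) by rewrite mulr_ge0.
have k1 := keep_le1 (K := K) deg_gt0 (feasible e S) n.+1 w.
have [Aw|NA] := pselect (feasible e S w); last by rewrite keepN // mulr0; lra.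
(* At the lower end T_S is already trapped; at the upper end [lin] is 1 and the bound is trivial. *)
have [Mb|Mb] := eqVneq (M w) (- (D + N)%:Z).
  by exfalso; apply: not_feasible_down Aw => //; rewrite Mb.
have [Mt|Mt] := eqVneq (M w) (D - N)%:Z.
  have -> : lin (M w) = 1.
    rewrite /lin Mt -pmulrn DN (_ : _ - _ + _ + _ = 2 * D%:R) ?divff //; last by ring.
    by rewrite mulf_neq0 ?gt_eqF // pnatr_eq0.
  have : n.+1%:R * keep e (feasible e S) n.+1 w <= n.+1%:R * 1 :> K by apply: ler_wpM2l => //; exact: k1.
  lra.
case: w w0 Aw Mdrop Ml Mu Ml' Mu' b0 b1 prod0 quad0 lin0 n0 k1 Mb Mt => // x h _ Aw Mdrop Ml Mu Ml' Mu' b0 b1 prod0 quad0 lin0 n0 k1 Mb Mt.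
(* The copy of [keep] split off from [n.+1] is at most 1. The mean decrease of [quad], at least 1
   per step by [lift_drift], pays for it. *)
suff : n%:R * keep e (feasible e S) n.+1 (x :: h) <= n%:R * lin (M (x :: h)) + quad (x :: h) - 1.
  by rewrite -natr1 !mulrDl !mul1r; lra.
rewrite keepS // -avgZ.
pose c1 : K := n%:R / (2 * D%:R) + 3 * (D%:R - N%:R - (D%:R + N%:R)).
pose c0 : K := n%:R * ((D%:R + N%:R) / (2 * D%:R)) + 3 * (D%:R + N%:R) * (D%:R - N%:R) + 1.
have expand z : n%:R * lin (M z) + quad z =
    c1 * (M z)%:~R + (- 1 * (3 * (M z)%:~R ^+ 2 + b z) + c0).
  rewrite /lin /quad /c1 /c0; ring.
clearbody c0 c1.
apply: (@le_trans _ _ (avg e (x :: h) (fun y => c1 * (M [:: y, x & h])%:~R +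
   (- 1 * (3 * (M [:: y, x & h])%:~R ^+ 2 + b [:: y, x & h]) + c0)))).
  apply: le_avg => y exy; rewrite -expand; apply: IHn => //.
    by have := lift_step HL h exy; lia.
  case=> // k; rewrite /= ltnS => kh.
  case: k kh => [|k] kh /=; first exact: Mu.
  exact: (Mdrop k.+1 kh).
rewrite !avgD !avgZ (lift_mean HL) avg_cst // expand.
have := lift_drift HL x h; rewrite avgD avgZ; lra.
Qed.

Lemma keep_one_sided R n : is_walk e R -> (4 * (n + 2 * N) < D)%N ->
  exists m, keep e (feasible e S) m (hist R n) <= 1 - 1 / 4 :> K.
Proof.
move=> wR nD.
have D0 : 0 < D%:R :> K by rewrite ltr0n (leq_ltn_trans _ ND).
have Mb k : (k <= n)%N -> `|M (hist R k)| <= (n + N)%:Z.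
  by move=> kn; apply: (le_trans (lift_bound k wR)); rewrite lez_nat leq_add2r.
have M0 := Mb n (leqnn n).
set w := hist R n in M0 *.
(* This horizon makes [quad w / m] at most 1/8; since [lin (M w)] is at most 5/8, the sum is at most
   3/4. *)
pose m := (Num.bound (8 * quad w)).+1.
have qm : 8 * quad w <= m%:R.
  have [q0|q0] := ltP (8 * quad w) 0; first by apply: (le_trans (ltW q0)).
  by rewrite ltW // (lt_le_trans (archi_boundP q0)) // ler_nat.
exists m.
have Hk : m%:R * keep e (feasible e S) m w <= m%:R * lin (M w) + quad w.
  apply: keep_martingale.
  - by rewrite /w; case: (n).
  - by move: M0; lia.
  - move=> k; rewrite /w size_hist ltnS => /andP[_ kn]; rewrite drop_hist //.
    by have := Mb (n - k)%N (leq_subr _ _); lia.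
have m0 : 0 < m%:R :> K by rewrite ltr0n.
have : lin (M w) <= 5 / 8.
  rewrite /lin ler_pdivrMr ?mulr_gt0 //.
  have : (M w)%:~R <= n%:R + N%:R :> K.
    have : M w <= (n + N)%:Z by lia.
    by rewrite -(ler_int K) -pmulrn natrD.
  have : 4 * (n%:R + 2 * N%:R) <= D%:R :> K.
    by move: nD => /ltnW; rewrite -(ler_nat K) natrM natrD natrM.
  lra.
move=> Hlin.
have {}Hlin : m%:R * lin (M w) <= m%:R * (5 / 8) by rewrite ler_wpM2l // ltW.
rewrite -(ler_pM2l m0); lra.
Qed.

End Martingale.

(** The scale D grows with the length of the history, but the bound 1/4 does not, as [prob_keep0]
    requires. *)
Lemma keep_lifts {K : realType} {T : finType} (e : rel T) S N M (b : seq T -> K) L :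
  (forall x, (0 < #|e x|)%N) -> lifts e S N M b L ->
  forall w, exists m, keep e (feasible e S) m w <= 1 - 1 / 4 :> K.
Proof.
move=> deg_gt0 HL w.
have [Aw|NA] := pselect (feasible e S w); last by exists 0%N; rewrite keepN //; lra.
case: Aw => R [n [_ [wR <- _]]].
pose D := (4 * (n + 2 * N) + N).+1.
have ND : (N < D)%N by rewrite /D; lia.
have nD : (4 * (n + 2 * N) < D)%N by rewrite /D; lia.
(* Whichever of [D] and [-D] the lift of T_S reaches first, T_R goes the other way. *)
have [up|] := pselect (forall j, L j <= - D%:Z -> exists2 j', (j' <= j)%N & D%:Z <= L j').
  exact: (keep_one_sided deg_gt0 HL ND up wR nD).
move=> /existsNP[j /not_implyP[Lj noup]].
apply: (keep_one_sided deg_gt0 (lifts_opp HL) ND _ wR nD) => j2 Lj2.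
exists j; last by lia.
rewrite leqNgt; apply/negP => jj; apply: noup; exists j2; first exact: ltnW.
lia.
Qed.

Section ColourLift.
Context {T : finType} (e : rel T) (N : nat) (colour : seq T -> nat).

(* Signed length of a move between cyclically adjacent colours of Z/N. *)
Definition turn (a c : nat) : int :=
  if c == a then 0 else if c == (if a.+1 == N then 0 else a.+1)%N then 1 else -1.

Fixpoint colour_lift (w : seq T) : int :=
  match w with
  | [::] => 0
  | _ :: h => if h is _ :: _ then colour_lift h + turn (colour h) (colour w)
              else (colour w)%:Z
  end.

Lemma colour_lift_cons x y h : colour_lift [:: y, x & h] =
  colour_lift (x :: h) + turn (colour (x :: h)) (colour [:: y, x & h]).
Proof. by []. Qed.

Lemma turn_le1 a c : `|turn a c| <= 1.
Proof. by rewrite /turn; do 2?case: ifP. Qed.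

Lemma colour_lift_hist R n : colour_lift (hist R n.+1) =
  colour_lift (hist R n) + turn (colour (hist R n)) (colour (hist R n.+1)).
Proof. by case: n. Qed.

Hypothesis colour_lt : forall w, (0 < N)%N -> (colour w < N)%N.
Hypothesis N_gt0 : (0 < N)%N.
Hypothesis adjacent : forall R n, is_walk e R ->
  let a := colour (hist R n) in let c := colour (hist R n.+1) in
  [\/ c = a, c = if a.+1 == N then 0%N else a.+1 | a = if c.+1 == N then 0%N else c.+1].

Lemma colour_lift_mod R n : is_walk e R ->
  exists z : int, colour_lift (hist R n) = (colour (hist R n))%:Z + z * N%:Z.
Proof.
move=> wR; elim: n => [|n [z IHn]]; first by exists 0; rewrite mul0r addr0.
have := adjacent n wR; rewrite colour_lift_hist IHn /turn /=.
have := colour_lt (hist R n) N_gt0; have := colour_lt (R n.+1 :: hist R n) N_gt0.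
move: (colour (R n.+1 :: hist R n)) (colour (hist R n)) => c a cN aN.
have [->|ca] := eqVneq c a; first by exists z; rewrite addr0.
case: (eqVneq c (if a.+1 == N then 0%N else a.+1)) => [-> _|ca1].
  case: eqP => aN1; last by exists z; lia.
  by exists (z + 1); rewrite mulrDl mul1r; lia.
case=> [/eqP|/eqP|ac]; rewrite ?(negbTE ca) ?(negbTE ca1) //.
move: ac; case: eqP => cN1 ac; last by exists z; lia.
by exists (z - 1); rewrite mulrBl mul1r; lia.
Qed.

Variable S : nat -> T.
Hypothesis wS : is_walk e S.
Hypothesis separated : forall R V i j, is_walk e R -> is_walk e V ->
  R i <> V j -> R i.+1 <> V j ->
  colour (hist R i.+1) = colour (hist R i) \/
  colour (hist R i.+1) <> colour (hist V j).

(** The difference of the lifts starts strictly between -N and N and changes by at most 1 per move.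
    To leave that range it would have to equal N or -N, making the colours equal, which [separated]
    forbids after a move that changes a colour. *)
Lemma colour_lift_track R i j : is_walk e R -> reach R S i j ->
  `|colour_lift (hist R i) - colour_lift (hist S j)| < N%:Z.
Proof.
move=> wR.
have fit (x y : int) (a c : nat) : (a < N)%N -> (c < N)%N -> a <> c ->
    (exists z, x = a%:Z + z * N%:Z) -> (exists z, y = c%:Z + z * N%:Z) ->
    `|x - y| <= N%:Z -> `|x - y| < N%:Z.
  move=> aN cN ac [z ->] [z' ->].
  rewrite lt_neqAle => ->; rewrite andbT; apply/negP => /eqP H.
  have [q Eq] : exists q : int, a%:Z - c%:Z = q * N%:Z.
    have E : a%:Z + z * N%:Z - (c%:Z + z' * N%:Z) = N%:Z \/
         a%:Z + z * N%:Z - (c%:Z + z' * N%:Z) = - N%:Z by lia.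
    by case: E => E; [exists (1 - z + z')|exists (- 1 - z + z')]; rewrite !mulrDl !mulNr mul1r; lia.
  have [q0|q1] : q = 0 \/ 1 <= `|q| by lia.
    by move: Eq; rewrite q0 mul0r; lia.
  nia.
elim=> [H|{}i {}j r IH H|{}i {}j r IH H].
- rewrite /=; have := colour_lt [:: R 0%N] N_gt0; have := colour_lt [:: S 0%N] N_gt0; lia.
- have t1 := turn_le1 (colour (hist R i)) (colour (hist R i.+1)).
  have [E|ne] := separated wR wS (reach_neq r) H.
    by rewrite colour_lift_hist E /turn eqxx addr0; exact: IH.
  apply: (fit _ _ _ _ (colour_lt _ N_gt0) (colour_lt _ N_gt0) ne);
    try exact: colour_lift_mod.
  by rewrite colour_lift_hist; lia.
- have t1 := turn_le1 (colour (hist S j)) (colour (hist S j.+1)).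
  have [E|ne] := separated wS wR (not_eq_sym (reach_neq r)) (not_eq_sym H).
    by rewrite colour_lift_hist E /turn eqxx addr0; exact: IH.
  apply: (fit _ _ _ _ (colour_lt _ N_gt0) (colour_lt _ N_gt0) (not_eq_sym ne));
    try exact: colour_lift_mod.
  by rewrite colour_lift_hist; lia.
Qed.

End ColourLift.

Section SmallDegreeAverages.
Context {K : realType} {T : finType} (e : rel T).

Lemma avg1 x h y (f : T -> K) : e x =i pred1 y -> avg e (x :: h) f = f y.
Proof.
by move=> ex; rewrite /avg (eq_card ex) card1 (eq_bigl _ _ ex) big_pred1_eq invr1 mul1r.
Qed.

Lemma avg2 x h y1 y2 (f : T -> K) : y1 != y2 -> e x =i pred2 y1 y2 ->
  avg e (x :: h) f = (f y1 + f y2) / 2.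
Proof.
move=> ne ex; rewrite /avg (eq_card ex) card2 ne (eq_bigl _ _ ex) mulrC.
rewrite (bigD1 y1) ?inE ?eqxx //= (big_pred1 y2) // => y /=.
rewrite !inE; case: (eqVneq y y1) => [->|_]; first by rewrite (negbTE ne).
by rewrite andbT.
Qed.

Lemma avg3 x h y1 y2 y3 (f : T -> K) : uniq [:: y1; y2; y3] ->
  e x =i [:: y1; y2; y3] -> avg e (x :: h) f = (f y1 + f y2 + f y3) / 3.
Proof.
move=> u ex; rewrite /avg (eq_card ex) (card_uniqP u) (eq_bigl _ _ ex).
by rewrite -big_uniq // !big_cons big_nil /= addr0 addrA mulrC.
Qed.

End SmallDegreeAverages.

Section CycleLift.
Context {K : realType} {T : finType} (e : rel T) (n : nat) (h : T -> 'I_n).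
Hypothesis n3 : (3 <= n)%N.
Hypothesis h_bij : bijective h.
Hypothesis he : {mono h : x y / e x y >-> cycle_rel x y}.
Variable S : nat -> T.
Hypothesis wS : is_walk e S.

Definition cycle_colour (w : seq T) : nat := if w is x :: _ then h x else 0%N.

Lemma modnS k : (k < n)%N -> (k.+1 %% n)%N = if k.+1 == n then 0%N else k.+1.
Proof.
move=> kn; case: eqP => [->|kN]; first by rewrite modnn.
by rewrite modn_small //; lia.
Qed.

Lemma cycle_lifts : lifts e S n (colour_lift n cycle_colour) (fun=> 0 : K)
  (fun j => colour_lift n cycle_colour (hist S j)).
Proof.
have h_inj := bij_inj h_bij; case: (h_bij) => g hg gh.
have colE (V : nat -> T) k : cycle_colour (hist V k) = h (V k) by case: k.
have n0 : (0 < n)%N by lia.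
have adj x y : e x y -> (h y = (if (h x).+1 == n then 0 else (h x).+1) :> nat)%N \/
    (h x = (if (h y).+1 == n then 0 else (h y).+1) :> nat)%N.
  by rewrite -he /cycle_rel !modnS //; move=> /orP[/eqP|/eqP]; [left|right].
have nxt x : ((if (h x).+1 == n then 0 else (h x).+1) < n)%N.
  by have := ltn_ord (h x); case: eqP; lia.
have prv x : ((if h x == 0%N :> nat then n.-1 else (h x).-1) < n)%N.
  by have := ltn_ord (h x); case: eqP; lia.
have two x w (f : T -> K) : avg e (x :: w) f =
    (f (g (Ordinal (nxt x))) + f (g (Ordinal (prv x)))) / 2.
  apply: avg2.
    apply/eqP => /(congr1 h); rewrite !gh => /(congr1 val) /=.
    by have := ltn_ord (h x); do 2?case: eqP; lia.
  move=> y; rewrite !inE -[LHS]/(e x y) -he /cycle_rel !modnS //.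
  rewrite -!(inj_eq h_inj) !gh -!val_eqE /=.
  by have := ltn_ord (h x); have := ltn_ord (h y); do ?case: eqP; lia.
have liftP x w : colour_lift n cycle_colour [:: g (Ordinal (nxt x)), x & w] =
    colour_lift n cycle_colour (x :: w) + 1.
  rewrite colour_lift_cons /turn /= gh /= eqxx.
  by have := ltn_ord (h x); do 2?case: eqP; lia.
have liftM x w : colour_lift n cycle_colour [:: g (Ordinal (prv x)), x & w] =
    colour_lift n cycle_colour (x :: w) - 1.
  rewrite colour_lift_cons /turn /= gh /=.
  by have := ltn_ord (h x); do 4?case: eqP; lia.
split.
- by move=> x /=; have := ltn_ord (h x); lia.
- by move=> x y w _; rewrite colour_lift_cons addrC addKr turn_le1.
- by move=> x w; rewrite two liftP liftM !rmorphD rmorphN /=; field.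
- by move=> w; rewrite lexx ler01.
- by move=> x w; rewrite two liftP liftM !rmorphD rmorphN /=; lra.
move=> R i j; apply: (colour_lift_track (e := e)) => //.
- by case=> [|x w] // _; exact: ltn_ord.
- move=> V k wV; rewrite /= colE; have [?|?] := adj _ _ (wV k); [by constructor 2|by constructor 3].
- move=> V W k l _ _ _ H; right; rewrite !colE => /val_inj /h_inj; exact: H.
Qed.

End CycleLift.

Section ClawLift.
Context {K : realType} {T : finType} (e : rel T) (h : T -> 'I_4).
Hypothesis h_bij : bijective h.
Hypothesis he : {mono h : x y / e x y >-> claw_rel x y}.
Variable S : nat -> T.
Hypothesis wS : is_walk e S.

(* The last leaf visited: while T_R crosses the centre T_S cannot move, so    *)
(* the tokens behave like lazy walkers on the triangle of leaves.             *)
Fixpoint leaf_colour (w : seq T) : nat :=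
  if w is x :: w' then (if h x == 0%N :> nat then leaf_colour w' else (h x).-1) else 0%N.

Lemma leaf_colour_lt w : (leaf_colour w < 3)%N.
Proof.
by elim: w => //= x w IHw; case: eqP => // _; have := ltn_ord (h x); lia.
Qed.

(** From the centre the lift moves by -1, 0 or 1 with equal probability: three times its square
    gains 2 on average while the correction drops from 1 to 0. From a leaf the lift rests and the
    correction rises from 0 to 1. The drift is 1 in both cases. *)
Lemma claw_lifts : lifts e S 3 (colour_lift 3 leaf_colour)
  (fun w => if w is x :: _ then (h x == 0%N :> nat)%:R else 0 : K)
  (fun j => colour_lift 3 leaf_colour (hist S j)).
Proof.
have h_inj := bij_inj h_bij; case: (h_bij) => g hg gh.
have g_inj : injective g := can_inj gh.
have lt k : (k < 4)%N -> exists2 y, h y = k :> nat & forall z, (z == y) = (h z == k :> nat).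
  move=> k4; exists (g (Ordinal k4)); first by rewrite gh.
  by move=> z; rewrite -(inj_eq h_inj) gh -val_eqE.
have [y0 hy0 y0E] := lt 0%N isT; have [y1 hy1 y1E] := lt 1%N isT.
have [y2 hy2 y2E] := lt 2%N isT; have [y3 hy3 y3E] := lt 3%N isT.
have exE x y : (y \in e x) = ((h x == 0%N :> nat) != (h y == 0%N :> nat)).
  by rewrite -[LHS]/(e x y) -he.
have one x w (f : T -> K) : h x != 0%N :> nat -> avg e (x :: w) f = f y0.
  by move=> hx; apply: avg1 => y; rewrite exE (negbTE hx) [in RHS]inE y0E; lia.
have three x w (f : T -> K) : h x = 0%N :> nat -> avg e (x :: w) f = (f y1 + f y2 + f y3) / 3.
  move=> hx; apply: avg3; first by rewrite /= !inE !y2E !y3E hy1 hy2.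
  move=> y; rewrite exE hx !inE y1E y2E y3E; have := ltn_ord (h y).
  by do ?case: eqP; lia.
have lift0 x w : colour_lift 3 leaf_colour [:: y0, x & w] =
    colour_lift 3 leaf_colour (x :: w).
  have c0 : leaf_colour [:: y0, x & w] = leaf_colour (x :: w) by rewrite /= hy0.
  by rewrite colour_lift_cons c0 /turn eqxx addr0.
have lift3 x w :
    exists a b c : int, [/\ colour_lift 3 leaf_colour [:: y1, x & w] =
        colour_lift 3 leaf_colour (x :: w) + a,
      colour_lift 3 leaf_colour [:: y2, x & w] = colour_lift 3 leaf_colour (x :: w) + b,
      colour_lift 3 leaf_colour [:: y3, x & w] = colour_lift 3 leaf_colour (x :: w) + c &
      [\/ [/\ a = 0, b = 1 & c = -1], [/\ a = -1, b = 0 & c = 1] | [/\ a = 1, b = -1 & c = 0]]].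
  do 3!eexists; split; [exact: colour_lift_cons|exact: colour_lift_cons|exact: colour_lift_cons|].
  have c1 : leaf_colour [:: y1, x & w] = 0%N by rewrite /= hy1.
  have c2 : leaf_colour [:: y2, x & w] = 1%N by rewrite /= hy2.
  have c3 : leaf_colour [:: y3, x & w] = 2%N by rewrite /= hy3.
  rewrite c1 c2 c3 /turn.
  have := leaf_colour_lt (x :: w); case: (leaf_colour _) => [|[|[|]]] //= _.
  - by constructor 1.
  - by constructor 2.
  - by constructor 3.
split.
- by move=> x /=; have := ltn_ord (h x); case: eqP; lia.
- by move=> x y w _; rewrite colour_lift_cons addrC addKr turn_le1.
- move=> x w; have [hx|hx] := eqVneq (h x : nat) 0%N; last by rewrite one // lift0.
  have [a [b [c [E1 E2 E3 abc]]]] := lift3 x w.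
  rewrite three // E1 E2 E3 !rmorphD /=.
  by case: abc => -[-> -> ->]; rewrite ?rmorphN /=; field.
- by case=> [|x w]; rewrite ?lexx ?ler01 //; case: eqP; rewrite ?lexx ler01.
- move=> x w; have [hx|hx] := eqVneq (h x : nat) 0%N; last first.
    rewrite one // lift0; move: (colour_lift 3 leaf_colour (x :: w)) => z.
    by rewrite hy0 /=; lra.
  have [a [b [c [E1 E2 E3 abc]]]] := lift3 x w.
  rewrite three // E1 E2 E3 hy1 hy2 hy3; move: (colour_lift 3 leaf_colour (x :: w)) => z.
  by case: abc => -[-> -> ->]; rewrite !rmorphD ?rmorphN /=; lra.
move=> R i j; apply: (colour_lift_track (e := e)) => //.
- by move=> w _; exact: leaf_colour_lt.
- move=> V k wV a c; rewrite {}/a {}/c.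
  have := leaf_colour_lt (hist V k); have := leaf_colour_lt (hist V k.+1).
  move: (leaf_colour _) (leaf_colour _) => [|[|[|]]] // [|[|[|]]] // _ _;
    by [constructor 1|constructor 2|constructor 3].
move=> V W k l wV wW H1 H2.
have leaf (U : nat -> T) t : h (U t) != 0%N :> nat -> leaf_colour (hist U t) = (h (U t)).-1.
  by case: t => [|t] /= /negbTE ->.
(* A move to the centre keeps the colour. A move out of the centre finds the other token on a leaf,
   and on a different one. *)
have [hV|hV] := eqVneq (h (V k.+1) : nat) 0%N; first by left; rewrite /= hV.
have hV0 : h (V k) = 0%N :> nat.
  by have := wV k; rewrite -he /claw_rel; move: hV; lia.
have hW : h (W l) != 0%N :> nat.
  by apply/eqP => E; apply: H1; apply: h_inj; apply: val_inj; rewrite /= E hV0.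
right; rewrite !leaf // => E; apply: H2; apply: h_inj; apply: val_inj => /=.
by move: hV hW E; case: (h (V k.+1) : nat) => // m; case: (h (W l) : nat) => // m' _ _ /= ->.
Qed.

End ClawLift.

(** * Existence of random walks *)

Section UniformOnUnitInterval.
Context {K : realType}.

Definition unif : probability (measurableTypeR K) K := uniform_prob (@ltr01 K).

Lemma uniform_prob_itv (a b : K) : 0 <= a -> a <= b -> b <= 1 ->
  unif `[a, b[%classic = (b - a)%:E.
Proof.
move=> a0 ab b1; rewrite -[LHS]/(uniform_prob (@ltr01 K) _) /uniform_prob (eq_integral (fun=> 1%:E)); last first.
  move=> x; rewrite inE /= in_itv /= => /andP[ax xb].
  by rewrite /uniform_pdf (le_trans a0 ax) (ltW (lt_le_trans xb b1)) /= subr0 invr1.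
rewrite integral_cst //= mul1e.
transitivity (if a < b then (b%:E - a%:E)%E else 0%E).
  exact: lebesgue_measure_itv.
by case: ltgtP ab => // -> _; rewrite subrr.
Qed.

Lemma uniform_prob_unit A : measurable A -> unif A = unif (A `&` `[0, 1[%classic).
Proof.
move=> mA; have mI : measurable (`[0, 1[%classic : set K) by [].
have I1 : unif `[0, 1[%classic = 1%E by rewrite uniform_prob_itv // subr0.
rewrite -[in LHS](setIT A) -(setUv `[0, 1[%classic) setIUr measureU //; last 3 first.
- exact: measurableI.
- by apply: measurableI => //; exact: measurableC.
- by rewrite setIACA setICr setI0.
rewrite [X in (_ + X)%E](_ : _ = 0%E) ?adde0 //.
apply/eqP; rewrite eq_le measure_ge0 andbT.
apply: (@le_trans _ _ (unif (~` `[0, 1[%classic))).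
  apply: le_measure; rewrite ?inE; last exact: subIsetr.
    by apply: measurableI => //; exact: measurableC.
  exact: measurableC.
by rewrite probability_setC // [X in (_ - X)%E]I1 subee.
Qed.

End UniformOnUnitInterval.

(* A random walk driven by one uniform variable on [0, 1[: the histories of   *)
(* length n partition the interval, and each step subdivides them evenly.     *)
Section RandomWalkExists.
Context {K : realType} {T : finType} (e : rel T) (x0 : T).
Hypothesis deg_gt0 : forall x, (0 < #|e x|)%N.

Definition choices (h : seq T) : seq T := if h is x :: _ then enum (e x) else enum T.

Fixpoint cell_len (h : seq T) : K :=
  if h is _ :: h' then cell_len h' / (size (choices h'))%:R else 1.

Fixpoint cell_lo (h : seq T) : K :=
  if h is y :: h' then cell_lo h' + cell_len h * (index y (choices h'))%:R else 0.

Definition in_cell h (u : K) := cell_lo h <= u < cell_lo h + cell_len h.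

Definition next_vertex h u :=
  nth x0 (choices h) (find (fun y => in_cell (y :: h) u) (choices h)).

Fixpoint unit_walk n u : seq T :=
  if n is m.+1 then next_vertex (unit_walk m u) u :: unit_walk m u
  else [:: next_vertex [::] u].

Fixpoint valid (h : seq T) : bool :=
  if h is y :: h' then (y \in choices h') && valid h' else true.

Lemma choices_gt0 h : (0 < size (choices h))%N.
Proof.
by case: h => [|x h] /=; rewrite -cardE //; apply/card_gt0P; exists x0.
Qed.

Lemma choices_uniq h : uniq (choices h).
Proof. by case: h => [|x h]; exact: enum_uniq. Qed.

Lemma cell_len_gt0 h : 0 < cell_len h.
Proof.
by elim: h => //= y h IHh; rewrite divr_gt0 // ltr0n choices_gt0.
Qed.

Lemma cell_lenS y h : cell_len h = cell_len (y :: h) * (size (choices h))%:R.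
Proof. by rewrite /= divfK // pnatr_eq0 -lt0n choices_gt0. Qed.

Lemma sub_cell y h u : y \in choices h -> in_cell (y :: h) u -> in_cell h u.
Proof.
rewrite -index_mem /in_cell /= => yh; have := cell_lenS y h; have := cell_len_gt0 (y :: h).
rewrite -[_ / _]/(cell_len (y :: h)); move: (cell_len (y :: h)) (cell_len h) => q l q0 ->.
have i0 : 0 <= q * (index y (choices h))%:R by rewrite mulr_ge0 // ltW.
have i1 : q * (index y (choices h))%:R + q <= q * (size (choices h))%:R.
  by rewrite -[X in _ + X]mulr1 -mulrDr ler_pM2l // natr1 ler_nat.
lra.
Qed.

Lemma in_some_cell h u : in_cell h u -> has (fun y => in_cell (y :: h) u) (choices h).
Proof.
rewrite /in_cell => /andP[lu ul]; have := cell_len_gt0 (x0 :: h).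
have E := cell_lenS x0 h; set q := cell_len (x0 :: h) in E * => q0.
have t0 : 0 <= (u - cell_lo h) / q by rewrite divr_ge0 ?subr_ge0 // ltW.
have /andP[kt tk] := truncn_itv t0; set k := Num.truncn _ in kt tk.
have km : (k < size (choices h))%N.
  rewrite -(ltr_nat K) (le_lt_trans kt) // ltr_pdivrMr // mulrC -E; lra.
apply/(has_nthP x0); exists k => //=; rewrite index_uniq ?choices_uniq //.
rewrite -[_ / _]/q; move: kt tk; rewrite ler_pdivlMr // ltr_pdivrMr // -natr1 mulrDl mul1r.
rewrite [_ * q]mulrC; lra.
Qed.

Lemma cell_unique h u y z : y \in choices h -> z \in choices h ->
  in_cell (y :: h) u -> in_cell (z :: h) u -> y = z.
Proof.
wlog le_yz : y z / (index y (choices h) <= index z (choices h))%N => [W|] yh zh.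
  by case/orP: (leq_total (index y (choices h)) (index z (choices h))) => /W H *;
    [exact: H | apply/esym; exact: H].
rewrite /in_cell /= => /andP[_ uy] /andP[zu _].
apply/eqP; rewrite -(inj_in_eq (@index_inj _ x0 (choices h))) //.
rewrite eqn_leq le_yz leqNgt; apply/negP => lt_yz.
have := cell_len_gt0 (y :: h) => /=; move: uy zu; set q := _ / _ => uy zu q0.
have : q * (index y (choices h))%:R + q <= q * (index z (choices h))%:R.
  by rewrite -[X in _ + X]mulr1 -mulrDr ler_pM2l // natr1 ler_nat.
lra.
Qed.

Lemma next_vertexE h u y : in_cell h u ->
  (next_vertex h u == y) = (y \in choices h) && in_cell (y :: h) u.
Proof.
move=> hu; have hs := in_some_cell hu.
have ch : next_vertex h u \in choices h by rewrite mem_nth // -has_find.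
have cu : in_cell (next_vertex h u :: h) u by exact: (nth_find x0 hs).
apply/eqP/andP => [<-//|[yh yu]]; exact: cell_unique cu yu.
Qed.

Lemma unit_walkE n u w : 0 <= u < 1 ->
  (unit_walk n u == w) = [&& size w == n.+1, valid w & in_cell w u].
Proof.
move=> u01; have u0 : in_cell [::] u by rewrite /in_cell /= add0r.
elim: n w => [|n IHn] [|y h] //=.
  rewrite eqseq_cons next_vertexE //; case: h => [|z h] //=; rewrite ?andbF ?andbT //.
rewrite eqseq_cons eqSS.
have [E|ne] := eqVneq (unit_walk n u) h; last first.
  rewrite andbF; apply/esym/negP => /and3P[sh /andP[yh vh] /(sub_cell yh) hu].
  by move: ne; rewrite IHn sh vh hu.
have := IHn h; rewrite E eqxx => /esym/and3P[-> vh hu].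
by rewrite vh next_vertexE //= !andbT.
Qed.

Lemma cell_sub_unit w u : valid w -> in_cell w u -> 0 <= u < 1.
Proof.
elim: w => [|y h IHh] /=; first by rewrite /in_cell /= add0r.
by case/andP=> yh vh /(sub_cell yh); exact: IHh.
Qed.

Lemma unit_walk_hist n u : unit_walk n u = hist (fun i => head x0 (unit_walk i u)) n.
Proof. by elim: n => //= n <-. Qed.

(** [random_walk] asks every outcome, not almost every one, to give a walk; reals outside the unit
    interval follow the walk driven by 0. *)
Definition clamp (u : K) : K := if 0 <= u < 1 then u else 0.

Lemma clamp01 u : 0 <= clamp u < 1.
Proof. by rewrite /clamp; case: ifP => // _; rewrite lexx ltr01. Qed.

Definition unit_step n (u : measurableTypeR K) : T := head x0 (unit_walk n (clamp u)).

Lemma hist_unit_step n u : hist (unit_step^~ u) n = unit_walk n (clamp u).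
Proof. by rewrite unit_walk_hist. Qed.

Lemma measurable_cell w : measurable ([set u | in_cell w u] : set (measurableTypeR K)).
Proof.
rewrite (_ : mkset _ = `[cell_lo w, cell_lo w + cell_len w[%classic) //.
Qed.

Lemma hist_unit_step_cell n w : [set u | hist (unit_step^~ u) n = w] `&` `[0, 1[%classic
  = if (size w == n.+1) && valid w then [set u | in_cell w u] else set0.
Proof.
apply/seteqP; split=> u /=.
  rewrite in_itv /= hist_unit_step => -[/eqP Hw u01]; move: Hw.
  by rewrite /clamp u01 unit_walkE // => /and3P[-> ->].
case: ifP => //= /andP[sw vw] uw; have u01 := cell_sub_unit vw uw.
rewrite in_itv /= hist_unit_step; split=> //; apply/eqP.
by rewrite /clamp u01 unit_walkE // sw vw.
Qed.

Lemma measurable_hist_unit_step n w :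
  measurable [set u : measurableTypeR K | hist (unit_step^~ u) n = w].
Proof.
have mI : measurable (`[0, 1[%classic : set (measurableTypeR K)) by [].
rewrite -[X in measurable X](setIT _) -(setUv `[0, 1[%classic) setIUr.
apply: measurableU.
  by rewrite hist_unit_step_cell; case: ifP => // _; exact: measurable_cell.
rewrite (_ : _ `&` _ = if unit_walk n 0 == w then ~` `[0, 1[%classic else set0).
  by case: ifP => // _; exact: measurableC.
apply/seteqP; split=> u /=.
  rewrite in_itv /= hist_unit_step => -[<- /negP/negbTE u01].
  by rewrite /clamp u01 eqxx /= in_itv /= u01.
case: eqP => //= <-; rewrite in_itv /= => /negP/negbTE u01.
by rewrite hist_unit_step /clamp u01.
Qed.

Lemma prob_hist_unit_step n w : size w = n.+1 -> valid w ->
  unif [set u | hist (unit_step^~ u) n = w] = (cell_len w)%:E.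
Proof.
move=> sw vw; rewrite uniform_prob_unit; last exact: measurable_hist_unit_step.
rewrite hist_unit_step_cell sw eqxx vw /=.
rewrite (_ : mkset _ = `[cell_lo w, cell_lo w + cell_len w[%classic); last first.
  by apply/seteqP; split=> u /=; rewrite in_itv.
have l0 := cell_len_gt0 w.
have in0 : in_cell w (cell_lo w) by rewrite /in_cell lexx ltrDl.
have /andP[lo0 _] := cell_sub_unit vw in0.
have le1 : cell_lo w + cell_len w <= 1.
  rewrite leNgt; apply/negP => over.
  (* A cell overshooting 1 would contain this point, although cells lie within the unit interval. *)
  pose u := Num.max 1 (cell_lo w).
  have := @cell_sub_unit w u vw; rewrite /in_cell /u.
  by case: (leP 1 (cell_lo w)) => H; rewrite ?lexx ?(ltW H) ?over ?ltrDl ?l0 => /(_ isT); lra.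
have lo_le : cell_lo w <= cell_lo w + cell_len w by rewrite lerDl ltW.
by rewrite uniform_prob_itv // addrC addKr.
Qed.

Lemma random_walk_unit_step : random_walk e unif unit_step.
Proof.
have walkE n u : unit_walk n (clamp u) = hist (unit_step^~ u) n by rewrite hist_unit_step.
have vhist n u : valid (hist (unit_step^~ u) n).
  by have := unit_walkE n (hist (unit_step^~ u) n) (clamp01 u); rewrite walkE eqxx => /esym/and3P[].
split.
- move=> u n; have /= /andP[+ _] := vhist n.+1 u.
  by case: n => [|n] /=; rewrite mem_enum.
- move=> n x.
  rewrite (_ : _ @^-1` _ = \bigcup_(w in [set` [pred w : n.+1.-tuple T | head x0 w == x]])
     [set u | hist (unit_step^~ u) n = w]).
    apply: fin_bigcup_measurable => [|w _]; first exact: finite_finset.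
    exact: measurable_hist_unit_step.
  have hd u : head x0 (hist (unit_step^~ u) n) = unit_step n u by case: n.
  apply/seteqP; split=> u /=.
    move=> ux; have sz : size (hist (unit_step^~ u) n) == n.+1 by rewrite size_hist.
    by exists (Tuple sz) => //=; rewrite inE /= hd ux.
  by case=> w /=; rewrite inE => /eqP wx hw; rewrite -hd hw.
- move=> x; rewrite (_ : _ @^-1` _ = [set u | hist (unit_step^~ u) 0 = [:: x]]).
    by rewrite prob_hist_unit_step //= ?mem_enum // -cardE div1r.
  by apply/seteqP; split=> u /= [->].
move=> n v y vy.
have histE u : hist (unit_step^~ u) n = hist v n <->
    forall i, (i <= n)%N -> unit_step i u = v i by exact: hist_eq.
rewrite (_ : [set u | _ /\ _] = [set u | hist (unit_step^~ u) n.+1 = y :: hist v n]); last first.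
  apply/seteqP; split=> u /=; first by move=> [/histE -> ->].
  by move=> [-> /histE].
rewrite (_ : [set u | forall i, _] = [set u | hist (unit_step^~ u) n = hist v n]); last first.
  by apply/seteqP; split=> u /= /histE.
have hdv : choices (hist v n) = enum (e (v n)) by case: n {vy histE}.
have [vv|nv] := boolP (valid (hist v n)); last first.
  have empty k w : ~~ valid w -> [set u | hist (unit_step^~ u) k = w] = set0.
    by move=> nw; apply/seteqP; split=> u //= hw; move: (vhist k u); rewrite hw (negbTE nw).
  by rewrite !empty ?measure0 ?mul0e //= negb_and nv orbT.
rewrite !prob_hist_unit_step ?size_hist //=; last 2 first.
- by rewrite size_hist.
- by rewrite hdv mem_enum vv andbT.
by rewrite hdv -cardE EFinM.
Qed.

End RandomWalkExists.

(** * Cutting and gluing schedules *)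

Section NotEvasive.
Context {K : realType} {T : finType} (e : rel T).
Hypothesis deg_gt0 : forall x, (0 < #|e x|)%N.

(** Evasiveness speaks of all realizations of the random walk, so it is refuted on the constructed
    one, [unit_step]. *)
Lemma not_evasive (S : nat -> T) (c : K) : 0 < c ->
  (forall w, exists n, keep e (feasible e S) n w <= 1 - c) -> ~ evasive K e S.
Proof.
move=> c0 Hc [wS ev].
have rw := random_walk_unit_step (K := K) (S 0%N) deg_gt0.
have [mE] := ev _ _ _ _ rw.
rewrite (prob_keep0 deg_gt0 rw mE _ c0 Hc) ?ltxx // => o /= suc n.
have [j r] := successful_reachR suc n.
by have [walk _ _ _] := rw; exists ((unit_step e (S 0%N))^~ o), n, j.
Qed.

Hypothesis e_connected : forall x y : T, connect e x y.

Lemma path_not_evasive S : is_path_graph e -> ~ evasive K e S.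
Proof.
move=> [n [h [g hg gh] he]] ev; have wS := ev.1.
have n0 : (0 < n)%N := leq_ltn_trans (leq0n _) (ltn_ord (h (S 0%N))).
have n1 : (n.-1 < n)%N by rewrite prednK.
apply: not_evasive (ev).
  apply: (@exprn_gt0 K (#|T| + #|T|).+1 (#|T|%:R)^-1).
  by rewrite invr_gt0 ltr0n; apply/card_gt0P; exists (S 0%N).
move=> w; exists (#|T| + #|T|).+1; apply: keep_escape => // x w' _.
pose a := g (Ordinal n0); pose b := g (Ordinal n1).
have [q1 [p1 l1 s1]] := connecting_path e_connected x a.
have [q2 [p2 l2 s2]] := connecting_path e_connected a b.
exists (q1 ++ q2); split.
- by rewrite cat_path p1 l1.
- by rewrite size_cat leqW // leq_add.
apply: (path_not_feasible (can_inj hg) he wS (a := a) (b := b)).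
- by rewrite gh.
- by rewrite gh.
- have := mem_last x q1; rewrite l1 catrevE !(mem_cat, mem_rev) !inE.
  by case/orP=> ->; rewrite ?orbT.
have := mem_last a q2; rewrite l2 catrevE !(mem_cat, mem_rev) !inE.
case/orP=> [/eqP ->|->]; last by rewrite orbT.
have := mem_last x q1; rewrite l1 !inE.
by case/orP=> ->; rewrite ?orbT.
Qed.

Lemma cycle_not_evasive S : is_cycle_graph e -> ~ evasive K e S.
Proof.
move=> [n n3 [h hb he]] ev; apply: not_evasive (ev).
  by apply: (@divr_gt0 K 1 4); rewrite ?ltr01 ?ltr0n.
apply: keep_lifts => //; exact: (cycle_lifts n3 hb he ev.1).
Qed.

Lemma claw_not_evasive S : is_claw_graph e -> ~ evasive K e S.
Proof.
move=> [h hb he] ev; apply: not_evasive (ev).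
  by apply: (@divr_gt0 K 1 4); rewrite ?ltr01 ?ltr0n.
apply: keep_lifts => //; exact: (claw_lifts hb he ev.1).
Qed.

End NotEvasive.

Definition advance T (k : nat) (R : nat -> T) : nat -> T := fun t => R (k + t)%N.

Lemma advance_advance T a b (R : nat -> T) : advance a (advance b R) = advance (b + a) R.
Proof. by apply: funext => t; rewrite /advance addnA. Qed.

Section CutAndGlue.
Context {T : finType}.
Implicit Types R S : nat -> T.

Lemma reach_ext R R' S i j : reach R S i j -> (forall t, (t <= i)%N -> R t = R' t) ->
  reach R' S i j.
Proof.
elim=> [H|{}i {}j r IH H|{}i {}j r IH H] E.
- by apply: reach0; rewrite -E.
- by apply: reachR; [apply: IH => t /leqW; apply: E | rewrite -E].
- by apply: reachS; [exact: IH | rewrite -E].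
Qed.

(** The cut is the move of T_R out of column [m], made in row [l]; the second half starts just after
    it. *)
Lemma reach_cut R S n j : reach R S n j -> forall m k, n = (m.+1 + k)%N ->
  exists2 l, (l <= j)%N &
    reach R S m l /\ reach (advance m.+1 R) (advance l S) k (j - l).
Proof.
elim=> [//|{}n {}j r IH H m k|{}n {}j r IH H m k E].
  rewrite addSn => -[E]; case: k E => [|k] E; last first.
    have [|l lj [r1 r2]] := IH m k; first by rewrite E addSnnS.
    exists l => //; split=> //; apply: reachR => //.
    by rewrite /advance subnKC // addSn -E.
  rewrite addn0 in E; exists j => //; rewrite -E subnn; split=> //.
  by apply: reach0; rewrite /advance !addn0.
have [l lj [r1 r2]] := IH m k E; exists l; first exact: leqW.
split=> //; rewrite subSn //; apply: reachS => //.
by rewrite /advance -E addnS subnKC.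
Qed.

Lemma reach_glue R S m l : reach R S m l -> forall k j,
  reach (advance m.+1 R) (advance l S) k j -> reach R S (m.+1 + k) (l + j).
Proof.
move=> r k j; elim=> [H|{}k {}j r' IH H|{}k {}j r' IH H].
- by rewrite !addn0; apply: reachR => //; move: H; rewrite /advance !addn0.
- by rewrite addnS; apply: reachR => //; move: H; rewrite /advance addnS.
- by rewrite addnS; apply: reachS => //; move: H; rewrite /advance addnS.
Qed.

Lemma reach_column R S l : reach R S 0 l <-> forall t, (t <= l)%N -> R 0%N <> S t.
Proof.
split=> [r t tl|].
  have [i' i0 r'] := reach_leS r tl; move: i0 r'; rewrite leqn0 => /eqP -> r'.
  exact: reach_neq r'.
elim: l => [|l IHl] H; first by apply: reach0; exact: H.
by apply: reachS; [apply: IHl => t /leqW; apply: H | exact: H].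
Qed.

Lemma successful_consR R S : R 0%N <> S 0%N -> successful (advance 1 R) S -> successful R S.
Proof.
move=> H [m [iR iS ok]].
exists (fun k => if k is k'.+1 then m k' else true); split=> [n|n|[|k]].
- by have [k nk mk] := iR n; exists k.+1 => //; exact: leqW.
- by have [k nk mk] := iS n; exists k.+1 => //; exact: leqW.
- by rewrite !big_ord0.
rewrite !big_ord_recl /= add0n; exact: (ok k).
Qed.

Lemma successful_consS R S : R 0%N <> S 0%N -> successful R (advance 1 S) -> successful R S.
Proof.
move=> H [m [iR iS ok]].
exists (fun k => if k is k'.+1 then m k' else false); split=> [n|n|[|k]].
- by have [k nk mk] := iR n; exists k.+1 => //; exact: leqW.
- by have [k nk mk] := iS n; exists k.+1 => //; exact: leqW.
- by rewrite !big_ord0.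
rewrite !big_ord_recl /= add0n; exact: (ok k).
Qed.

Lemma successful_glue R S i j : reach R S i j ->
  successful (advance i R) (advance j S) -> successful R S.
Proof.
elim=> [//|{}i {}j r IH H suc|{}i {}j r IH H suc]; apply: IH.
  apply: successful_consR; first by rewrite /advance !addn0; exact: reach_neq r.
  by rewrite advance_advance addn1.
apply: successful_consS; first by rewrite /advance !addn0; exact: reach_neq r.
by rewrite advance_advance addn1.
Qed.

Lemma successful_glue_exit R S i j : reach R S i j ->
  successful (advance i.+1 R) (advance j S) -> successful R S.
Proof.
move=> r suc; apply: (successful_glue r); apply: successful_consR.
  by rewrite /advance !addn0; exact: reach_neq r.
by rewrite advance_advance addn1.
Qed.

Lemma successful_moves R S (m : nat -> bool) :
  (forall n, exists2 k, (n <= k)%N & m k) ->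
  (forall n, exists2 k, (n <= k)%N & ~~ m k) ->
  (forall k, R (\sum_(t < k) m t)%N <> S (\sum_(t < k) ~~ m t)%N) ->
  forall k, successful (advance (\sum_(t < k) m t) R) (advance (\sum_(t < k) ~~ m t) S).
Proof.
move=> iR iS ok k; exists (fun t => m (k + t)%N); split=> [n|n|s].
- by have [l nl ml] := iR (k + n)%N; exists (l - k)%N; rewrite ?subnKC //; lia.
- by have [l nl ml] := iS (k + n)%N; exists (l - k)%N; rewrite ?subnKC //; lia.
by have := ok (k + s)%N; rewrite !big_split_ord.
Qed.

Lemma successful_exits R S : successful R S -> forall n J, exists i j,
  [/\ (n <= i)%N, (J <= j)%N, reach R S i j & successful (advance i.+1 R) (advance j S)].
Proof.
case=> m [iR iS ok] n J.
have [k1 _ Hk1] := partial_sum_onto iR n; have [k2 _ Hk2] := partial_sum_onto iS J.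
have [k kk mk] := iR (maxn k1 k2).
have mono (b : nat -> bool) a : (a <= k)%N -> (\sum_(t < a) b t <= \sum_(t < k) b t)%N.
  by move=> ak; rewrite (big_ord_widen k (fun t => nat_of_bool (b t)) ak) big_mkcond leq_sum // => t _; case: ifP.
exists (\sum_(t < k) m t)%N, (\sum_(t < k) ~~ m t)%N; split.
- by rewrite -Hk1; apply: mono; move: kk; rewrite geq_max => /andP[].
- by rewrite -Hk2; apply: (mono (fun t => ~~ m t)); move: kk; rewrite geq_max => /andP[].
- exact: reach_moves.
by have := successful_moves iR iS ok k.+1; rewrite !big_ord_recr /= mk addn0 addn1.
Qed.

Lemma successful_cut R S m : successful R S ->
  exists2 l, reach R S m l & successful (advance m.+1 R) (advance l S).
Proof.
case=> f [iR iS ok]; have [k fk E] := partial_sum_onto iR m.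
exists (\sum_(t < k) ~~ f t)%N; first by rewrite -E; exact: reach_moves.
by have := successful_moves iR iS ok k.+1; rewrite !big_ord_recr /= fk addn0 addn1 E.
Qed.

End CutAndGlue.

(** * Infinite schedules described by their exit rows *)

Section Columns.
Context {T : finType} (R S : nat -> T) (u : nat -> nat).
Hypothesis u0 : u 0%N = 0%N.
Hypothesis u_open : forall i, (u i <= u i.+1)%N /\
  forall j, (u i <= j <= u i.+1)%N -> R i <> S j.
Hypothesis u_unbounded : forall J, exists i, (J <= u i)%N.

(** T_R enters column [i] in row [u i] and leaves it in row [u i.+1]; T_S climbs in between. *)
Fixpoint staircase (k : nat) : nat * nat :=
  if k is k'.+1 then
    let: (i, j) := staircase k' in if (j < u i.+1)%N then (i, j.+1) else (i.+1, j)
  else (0%N, 0%N).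

Let m k := ~~ ((staircase k).2 < u (staircase k).1.+1)%N.

Lemma staircase_bounds k :
  (u (staircase k).1 <= (staircase k).2 <= u (staircase k).1.+1)%N.
Proof.
elim: k => [|k] /=; first by rewrite u0.
case: (staircase k) => i j /= /andP[ij ji]; case: ifP => /= H; first by lia.
by have [H1 _] := u_open i.+1; lia.
Qed.

Lemma staircase_sum k :
  staircase k = (\sum_(t < k) m t, \sum_(t < k) ~~ m t)%N.
Proof.
elim: k => [|k IHk]; first by rewrite !big_ord0.
rewrite !big_ord_recr /=.
have : m k = ~~ ((staircase k).2 < u (staircase k).1.+1)%N by [].
rewrite IHk /= => ->.
by case: ifP => _ /=; rewrite ?addn0 ?addn1.
Qed.

Lemma successful_columns : successful R S.
Proof.
exists m; split=> [n|n|k].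
- apply: contrapT => no.
  have stay t : (staircase (n + t)).1 = (staircase n).1 /\
      (staircase (n + t)).2 = ((staircase n).2 + t)%N.
    elim: t => [|t [IH1 IH2]]; first by rewrite !addn0.
    have : ~~ m (n + t) by apply/negP => mt; apply: no; exists (n + t)%N; rewrite ?leq_addr.
    by rewrite negbK addnS /=; move: IH1 IH2; case: (staircase (n + t)) => i j /= -> -> ->; rewrite addnS.
  have [s1 s2] := stay (u (staircase n).1.+1).+1.
  have := staircase_bounds (n + (u (staircase n).1.+1).+1); rewrite s1 s2; lia.
- apply: contrapT => no.
  have stay t : (staircase (n + t)).1 = ((staircase n).1 + t)%N /\
      (staircase (n + t)).2 = (staircase n).2.
    elim: t => [|t [IH1 IH2]]; first by rewrite !addn0.
    have : m (n + t).
      by apply: contrapT => mt; apply: no; exists (n + t)%N; rewrite ?leq_addr //; apply/negP.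
    rewrite addnS /= /m; move: IH1 IH2; case: (staircase (n + t)) => i j /= -> -> /negbTE ->.
    by rewrite addnS.
  have [i Hi] := u_unbounded (staircase n).2.+1.
  have mono a b : (a <= b)%N -> (u a <= u b)%N.
    by apply: (homo_leq (r := leq)) => // [y x z|i']; [exact: leq_trans | case: (u_open i')].
  have [s1 s2] := stay i; have := staircase_bounds (n + i); rewrite s1 s2 => /andP[H _].
  have := mono i ((staircase n).1 + i)%N (leq_addl _ _); lia.
have := staircase_bounds k; rewrite staircase_sum /=.
by have [_] := u_open (\sum_(t < k) m t)%N; exact.
Qed.

End Columns.

Section Criterion.
Context {T : finType}.
Implicit Types R S : nat -> T.

(* T_R can be brought arbitrarily far with both tokens starting from here. *)
Definition alive R S : Prop := forall k, exists l, reach R S k l.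

(* Without infinite columns, a pair is successful iff T_S can be brought      *)
(* arbitrarily far without compromising T_R.                                  *)
Definition criterion R S : Prop := forall J, exists i j,
  [/\ (J <= j)%N, reach R S i j & alive (advance i.+1 R) (advance j S)].

Lemma successful_alive R S : successful R S -> alive R S.
Proof. exact: successful_reachR. Qed.

Lemma successful_criterion R S : successful R S -> criterion R S.
Proof.
move=> suc J; have [i [j [_ Jj r /successful_alive al]]] := successful_exits suc 0 J.
by exists i, j.
Qed.

(* Koenig's lemma at the exits of column 0. *)
Lemma alive_step R S : (exists t, R 0%N = S t) -> alive R S ->
  exists l, reach R S 0 l /\ alive (advance 1 R) (advance l S).
Proof.
move=> [t Rt] al; apply: contrapT => no.
have bad l : exists k, reach R S 0 l -> forall j, ~ reach (advance 1 R) (advance l S) k j.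
  have [r|nr] := pselect (reach R S 0 l); last by exists 0%N.
  have /existsNP[k nk] : ~ alive (advance 1 R) (advance l S) by move=> al'; apply: no; exists l.
  by exists k => _ j r'; apply: nk; exists j.
have [k Hk] := choice bad.
have [j r] := al (1 + \max_(l < t) k l)%N.
have [l lj [r1 r2]] := reach_cut r (erefl _).
have lt : (l < t)%N.
  by rewrite ltnNge; apply/negP => /((reach_column R S l).1 r1); rewrite Rt.
have [|j' _ r'] := reach_leR r2 (i' := k l).
  by have := leq_bigmax (Ordinal lt) (F := fun l : 'I_t => k l).
exact: (Hk l r1 j' r').
Qed.

Lemma alive_glue R S l : reach R S 0 l -> alive (advance 1 R) (advance l S) -> alive R S.
Proof.
move=> r al [|k]; first by exists l.
by have [j r'] := al k; exists (l + j)%N; apply: (reach_glue r r').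
Qed.

(** T_R leaves each column in the highest row from which it stays alive. Such a row exists because S
    meets every vertex of R in arbitrarily high rows, which bounds each column; [criterion] makes
    these rows unbounded, so T_S advances forever too. *)
Lemma criterion_successful R S :
  (forall i J, exists2 t, (J <= t)%N & R i = S t) -> criterion R S -> successful R S.
Proof.
move=> hit crit.
pose D i j := reach R S i j /\ alive (advance i.+1 R) (advance j S).
have D0 : exists l, D 0%N l.
  apply: alive_step; first by have [t _ Ht] := hit 0%N 0%N; exists t.
  have [i [j [_ r al]]] := crit 0%N => k; have [ki|ik] := leqP k i.
    by have [j' _ r'] := reach_leR r ki; exists j'.
  have [l r'] := al (k - i.+1)%N; exists (j + l)%N.
  by have := reach_glue r r'; rewrite subnKC.
have Dstep i j : D i j -> exists2 j', (j <= j')%N & D i.+1 j'.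
  move=> [r al].
  have [|l [r1 al']] := alive_step _ al.
    have [t jt Ht] := hit i.+1 j; exists (t - j)%N.
    by rewrite /advance addn0 subnKC.
  exists (j + l)%N; first exact: leq_addr.
  split; first by have := reach_glue r r1; rewrite addn0.
  by move: al'; rewrite !advance_advance addn1.
(* A column entered by row [B] is blocked at the next row [t >= B] where S visits its vertex. *)
have bound i : exists B, forall j, reach R S i j -> (j <= B)%N.
  elim: i => [|i [B IHB]].
    have [t _ Ht] := hit 0%N 0%N; exists t => j /reach_column r.
    by rewrite leqNgt; apply/negP => /ltnW /r.
  have [t Bt Ht] := hit i.+1 B; exists t => j r.
  have [l lj [r1 r2]] := reach_cut (m := i) (k := 0) r ltac:(by rewrite addn0).
  rewrite leqNgt; apply/negP => tj.
  have lt : (l <= t)%N := leq_trans (IHB l r1) Bt.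
  have := (reach_column _ _ _).1 r2 (t - l)%N; rewrite /advance addn0 subnKC // => H.
  by apply: H => //; lia.
have top i : exists j, D i j /\ forall j', D i j' -> (j' <= j)%N.
  have [j Dj] : exists j, D i j.
    by elim: i => [//|i [j /Dstep[j' _ Dj']]]; exists j'.
  have [B HB] := bound i.
  have ex : exists j, `[< D i j >] by exists j; apply/asboolP.
  have bd k : `[< D i k >] -> (k <= B)%N by move=> /asboolP[r _]; exact: HB.
  case: (ex_maxnP ex bd) => k /asboolP Dk maxk; exists k; split=> // k' /asboolP.
  exact: maxk.
have [v Hv] := choice top.
pose u i := if i is i'.+1 then v i' else 0%N.
apply: (@successful_columns _ R S u) => //.
- case=> [|i] /=.
    split=> // j jv; have [[r _] _] := Hv 0%N.
    exact: (reach_column _ _ _).1 r j jv.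
  have [Di maxi] := Hv i; have [Di1 maxi1] := Hv i.+1.
  have [j vj Dj] := Dstep _ _ Di.
  split; first exact: leq_trans vj (maxi1 _ Dj).
  move=> t /andP[vt tv]; case: Di1 => r al.
  have [l lv [r1 r2]] := reach_cut (m := i) (k := 0) r ltac:(by rewrite addn0).
  (* The exit [l] of column [i] used on the way to [v i.+1] also keeps T_R alive, so it is at most
     [v i]. Column [i.+1] is open from [l] on, in particular from [v i]. *)
  have Dl : D i l.
    split=> //; apply: (alive_glue r2); rewrite !advance_advance subnKC //.
    by rewrite addn1.
  have lt := leq_trans (maxi l Dl) vt.
  have := (reach_column _ _ _).1 r2 (t - l)%N; rewrite /advance addn0 subnKC //.
  by apply; rewrite leq_sub2r.
- move=> J; have [i [j [Jj r al]]] := crit J; exists i.+1 => /=.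
  by have [_ maxi] := Hv i; apply: (leq_trans Jj); apply: maxi.
Qed.

End Criterion.

Section Dodging.
Context {T : finType}.

(* T_S, following [ys], dodges T_R, following [rs]: before T_R leaves [r],    *)
(* T_S runs through [p] to the vertex where it stands when T_R moves.         *)
Inductive dodge : seq T -> seq T -> Prop :=
| dodge0 y ys : dodge [::] (y :: ys)
| dodgeS r rs p y ys : r \notin rcons p y -> dodge rs (y :: ys) ->
    dodge (r :: rs) (p ++ y :: ys).

Variables (H : pred T) (R S : nat -> T).
Hypothesis SH : forall j, H (S j).

Definition column_open i a b :=
  (a <= b)%N /\ forall j, (a <= j <= b)%N -> R i <> S j.

(* Entering column [i] in row [j], T_R can reach a vertex outside [H], where  *)
(* T_S is free to move.                                                       *)
Inductive escapes : nat -> nat -> Prop :=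
| escapes0 i j : ~~ H (R i) -> escapes i j
| escapesS i j j' : column_open i j j' -> escapes i.+1 j' -> escapes i j.

Lemma dodge_escapes rs ys i j : dodge rs ys ->
  (forall t, (t < size rs)%N -> R (i + t)%N = nth (R 0%N) rs t) ->
  (forall t, (t < size ys)%N -> S (j + t)%N = nth (S 0%N) ys t) ->
  ~~ H (R (i + size rs)%N) -> escapes i j.
Proof.
move=> d; elim: d i j => [y {}ys|r {}rs p y {}ys rN d IHd] i j Rrs Sys NH.
  by apply: escapes0; rewrite addn0 in NH.
apply: (@escapesS i j (j + size p)).
  split=> [|t /andP[jt tj]]; first exact: leq_addr.
  have -> : R i = r by have := Rrs 0%N isT; rewrite addn0.
  have tp : (t - j < size (rcons p y))%N by rewrite size_rcons; lia.
  have -> : S t = nth (S 0%N) (rcons p y) (t - j).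
    rewrite -{1}(subnKC jt) Sys.
      by rewrite -cat_rcons nth_cat tp.
    move: tp; rewrite size_cat addnS size_rcons !ltnS => tp; exact: leq_trans tp (leq_addr _ _).
  by move=> E; move: rN; rewrite E mem_nth.
apply: IHd => [t trs|t tys|].
- by rewrite addSnnS Rrs.
- rewrite -addnA Sys; last by rewrite size_cat ltn_add2l.
  by rewrite nth_cat ltnNge leq_addr /= addKn.
- by rewrite addSnnS.
Qed.

Hypothesis out : forall i, exists2 k, (i <= k)%N & ~~ H (R k).
Hypothesis dodgeable : forall rs i, (forall t, (t < size rs)%N -> R (i + t)%N = nth (R 0%N) rs t) ->
  forall J, exists2 j, (J <= j)%N & exists2 ys, dodge rs ys &
    forall t, (t < size ys)%N -> S (j + t)%N = nth (S 0%N) ys t.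

(** While T_R is outside [H] its whole column is open, and T_S can climb to a stretch of S that
    dodges R until a later vertex outside [H]. *)
Lemma escapes_step i j : escapes i j -> exists j',
  [/\ column_open i j j', escapes i.+1 j' & ~~ H (R i) -> (j < j')%N].
Proof.
move=> ev; have [Ri|Ri] := boolP (H (R i)).
  by case: ev Ri => [{}i {}j /negbTE -> //|{}i {}j j' co ev _]; exists j'.
have ex : exists k, ~~ H (R (i.+1 + k)%N).
  by have [k ik Rk] := out i.+1; exists (k - i.+1)%N; rewrite subnKC.
have [k Rk _] := ex_minnP ex.
pose rs := mkseq (fun t => R (i.+1 + t)%N) k.
have Rrs t : (t < size rs)%N -> R (i.+1 + t)%N = nth (R 0%N) rs t.
  by rewrite size_mkseq => tk; rewrite nth_mkseq.
have [j' jj' [ys d Sys]] := dodgeable Rrs j.+1.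
exists j'; split=> //.
- split=> [|t _]; first exact: ltnW.
  by move=> E; move: Ri; rewrite E SH.
- by apply: (dodge_escapes d Rrs Sys); rewrite size_mkseq.
Qed.

Lemma successful_escapes : ~~ H (R 0%N) -> successful R S.
Proof.
move=> R0.
have ex (ij : nat * nat) : exists j', escapes ij.1 ij.2 ->
    [/\ column_open ij.1 ij.2 j', escapes ij.1.+1 j' & ~~ H (R ij.1) -> (ij.2 < j')%N].
  have [ev|nev] := pselect (escapes ij.1 ij.2); last by exists 0%N.
  by have [j' Hj'] := escapes_step ev; exists j'.
have [f Hf] := choice ex.
pose u := fix u i := if i is i'.+1 then f (i', u i') else 0%N.
have uE i : escapes i (u i).
  elim: i => [|i IHi]; first exact: escapes0.
  by have [] := Hf (i, u i) IHi.
have uS i : (u i <= u i.+1)%N by have [[]] := Hf (i, u i) (uE i).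
have mono a b : (a <= b)%N -> (u a <= u b)%N.
  by apply: (homo_leq (r := leq)) => // x y z; exact: leq_trans.
apply: (@successful_columns _ R S u) => // [i|J].
  by have [co _ _] := Hf (i, u i) (uE i).
elim: J => [|J [i Hi]]; first by exists 0%N.
have [k ik Rk] := out i; exists k.+1.
have [_ _ /(_ Rk) lt] := Hf (k, u k) (uE k).
exact: leq_ltn_trans (leq_trans Hi (mono _ _ ik)) lt.
Qed.

End Dodging.

(** The walk is built in stages: stage [k] decodes a pair from the exponent of 2 in [k] and, if it
    is a walk in [H], goes to its start and follows it. Every stage adds a step, so the prefixes
    [L k] exhaust an infinite walk. *)
Lemma universal_walk (T : finType) (f : rel T) (H : pred T) (x0 : T) : H x0 ->
  (forall x y, H x -> H y -> connect f x y) ->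
  (forall x, H x -> exists y, f x y) -> (forall x y, f x y -> H y) ->
  exists S : nat -> T, [/\ S 0%N = x0, forall n, f (S n) (S n.+1) &
    forall y p, H y -> path f y p -> forall J, exists2 j, (J <= j)%N &
      forall t, (t < size (y :: p))%N -> S (j + t)%N = nth x0 (y :: p) t].
Proof.
move=> Hx0 conn nbr fH.
have lastH z q : H z -> path f z q -> H (last z q).
  by elim: q z => //= y q IHq z Hz /andP[/fH Hy]; exact: IHq.
have ext_ex (kz : nat * T) : exists q, H kz.2 -> [/\ path f kz.2 q, (0 < size q)%N &
    forall y p, unpickle (logn 2 kz.1) = Some (y, p) -> H y -> path f y p ->
      exists q1 q2, q = q1 ++ p ++ q2 /\ last kz.2 q1 = y].
  case: kz => k z /=; have [Hz|] := pselect (H z); last by exists [::].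
  have [y0 zy0] := nbr z Hz.
  have [[[y p] [E Hy pyp]]|no] := pselect (exists yp : T * seq T,
      [/\ unpickle (logn 2 k) = Some yp, H yp.1 & path f yp.1 yp.2]); last first.
    exists [:: y0] => _; split; rewrite /= ?zy0 // => y p E Hy pyp.
    by exfalso; apply: no; exists (y, p).
  have /connectP[q1 pq1 lq1] := conn z y Hz Hy.
  have [y1 ly1] := nbr _ (lastH _ _ Hy pyp).
  exists (q1 ++ p ++ [:: y1]) => _; split.
  - by rewrite !cat_path pq1 -lq1 pyp /= ly1.
  - by rewrite !size_cat addn1 addnS.
  move=> y' p'; rewrite E => -[<- <-] _ _; exists q1, [:: y1]; by rewrite -lq1.
have [ext Hext] := choice ext_ex.
pose L := fix L k := if k is k'.+1 then L k' ++ ext (k', last x0 (L k')) else [::].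
have pL k : path f x0 (L k).
  elim: k => //= k IHk; rewrite cat_path IHk /=.
  by have [] := Hext (k, last x0 (L k)) (lastH _ _ Hx0 IHk).
have sL k : (k <= size (L k))%N.
  elim: k => //= k IHk; rewrite size_cat.
  by have [_ + _] := Hext (k, last x0 (L k)) (lastH _ _ Hx0 (pL k)); rewrite /=; lia.
pose W k := x0 :: L k.
have sW k : (k < size (W k))%N by rewrite ltnS sL.
have stable k d n : (n < size (W k))%N -> nth x0 (W (k + d)%N) n = nth x0 (W k) n.
  move=> nk; elim: d => [|d IHd]; first by rewrite addn0.
  rewrite -IHd addnS /W /= -cat_cons nth_cat; case: ifP => // /negP[].
  apply: (leq_trans nk); elim: d {IHd} => [|d IHd]; first by rewrite addn0.
  by apply: (leq_trans IHd); rewrite addnS /= size_cat ltnS leq_addr.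
pose S n := nth x0 (W n) n.
have SW k n : (n < size (W k))%N -> S n = nth x0 (W k) n.
  move=> nk; case: (leqP k n) => [kn|/ltnW nk'].
    by rewrite /S -{1}(subnKC kn) stable.
  by rewrite -(subnKC nk') stable.
exists S; split=> // [n|y p Hy pyp J].
  have n1 := sW n.+1; rewrite (SW n.+1 n (ltnW n1)) (SW n.+1 n.+1 n1).
  by have /(pathP x0) /(_ n) := pL n.+1; apply; move: n1; rewrite ltnS.
(* The odd factor pushes the stage, hence the occurrence, beyond [J] without changing the encoded
   pair. *)
pose k := (2 ^ pickle (y, p) * 3 ^ J)%N.
have Ek : logn 2 k = pickle (y, p).
  by rewrite lognM ?expn_gt0 // pfactorK // lognX (_ : logn 2 3 = 0%N) // muln0 addn0.
have Jk : (J <= k)%N.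
  apply: (leq_trans (ltnW (ltn_expl J (isT : 1 < 3)%N))).
  by rewrite leq_pmull // expn_gt0.
have [_ _ /(_ y p)] := Hext (k, last x0 (L k)) (lastH _ _ Hx0 (pL k)).
rewrite /= Ek pickleK => /(_ erefl Hy pyp) [q1 [q2 [Eq lq]]].
have WE : W k.+1 = belast x0 (L k ++ q1) ++ (y :: p) ++ q2.
  rewrite /W /= Eq catA -cat_cons lastI last_cat lq cat_rcons //.
exists (size (belast x0 (L k ++ q1))).
  by rewrite size_belast size_cat (leq_trans Jk) // (leq_trans (sL k)) // leq_addr.
move=> t tp; have tp' : (size (belast x0 (L k ++ q1)) + t < size (W k.+1))%N.
  by rewrite WE size_cat ltn_add2l size_cat ltn_addr.
by rewrite (SW _ _ tp') WE nth_cat ltnNge leq_addr /= addKn -cat_cons nth_cat tp.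
Qed.

(** * Dodging grounds and evasive walks *)

Definition induced (T : finType) (e : rel T) (H : pred T) : rel T :=
  fun x y => [&& e x y, H x & H y].

Lemma third_element (T : eqType) (y1 y2 y3 : T) : uniq [:: y1; y2; y3] -> forall x z,
  exists y, [/\ y \in [:: y1; y2; y3], y != x & y != z].
Proof.
move=> u x z.
have : has [pred y | (y != x) && (y != z)] [:: y1; y2; y3].
  apply: contraT; rewrite -all_predC => /allP Hall.
  have := @uniq_leq_size _ [:: y1; y2; y3] [:: x; z] u; apply.
  by move=> y /Hall /=; rewrite negb_and !negbK !inE.
by case/hasP=> y yin /andP[yx yz]; exists y.
Qed.

(* A token knowing the future of T_R can dodge it without leaving [H]. *)
Definition dodging_ground (T : finType) (e : rel T) (H : pred T) : Prop :=
  [/\ forall x y, H x -> H y -> connect (induced e H) x y,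
      forall x, H x -> exists y, induced e H x y &
      forall rs, sorted e rs -> exists y p,
        [/\ H y, path (induced e H) y p & dodge rs (y :: p)]].

(** When T_R is about to step onto T_S, the token T_S moves to the third vertex, which is neither
    the present nor the next vertex of T_R. *)
Lemma triangle_dodging (T : finType) (e : rel T) (a b c : T) :
  symmetric e -> irreflexive e -> e a b -> e b c -> e c a ->
  dodging_ground e [in [:: a; b; c]].
Proof.
move=> e_sym e_irr eab ebc eca.
set H : pred T := [in [:: a; b; c]].
have Ne x y : e x y -> x != y by apply: contraTneq => ->; rewrite e_irr.
have u : uniq [:: a; b; c].
  by rewrite /= !inE negb_or (Ne _ _ eab) (Ne _ _ ebc) eq_sym (Ne _ _ eca).
have adj x y : H x -> H y -> x != y -> induced e H x y.
  move=> Hx Hy ne; rewrite /induced Hx Hy !andbT; move: Hx Hy ne.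
  by rewrite /H !inE => /or3P[] /eqP -> /or3P[] /eqP ->; rewrite ?eqxx // e_sym.
split=> [x y Hx Hy|x Hx|rs _].
- have [->|ne] := eqVneq x y; first exact: connect0.
  by apply: connect1; exact: adj.
- by have [y [Hy yx _]] := third_element u x x; exists y; apply: adj; rewrite // eq_sym.
have main y : H y -> (if rs is r :: _ then y != r else true) ->
    exists p, path (induced e H) y p /\ dodge rs (y :: p).
  elim: rs y => [|r rs IHrs] y Hy yr; first by exists [::]; split=> //; exact: dodge0.
  have stay : (if rs is r' :: _ then y != r' else true) ->
      exists p, path (induced e H) y p /\ dodge (r :: rs) (y :: p).
    move=> /(IHrs y Hy)[p [pp d]]; exists p; split=> //.
    by apply: (@dodgeS _ r rs [::]) => //; rewrite inE eq_sym.
  case: rs stay IHrs => [|r' rs] stay IHrs; first exact: stay.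
  have [E|/stay//] := eqVneq y r'.
  have [z [Hz zr zy]] := third_element u r y.
  have [|p [pp d]] := IHrs z Hz; first by rewrite -E.
  exists (z :: p); split; first by rewrite /= adj // eq_sym.
  by apply: (@dodgeS _ r (r' :: rs) [:: y]) => //; rewrite !inE negb_or !(eq_sym r) yr zr.
have [y [Hy yr _]] := third_element u (head a rs) a.
have [|p [pp d]] := main y Hy; first by case: (rs) yr.
by exists y, p.
Qed.

Lemma claw_dodging (T : finType) (e : rel T) (c a b d : T) :
  symmetric e -> irreflexive e -> e c a -> e c b -> e c d ->
  uniq [:: a; b; d] -> dodging_ground e [in [:: c; a; b; d]].
Proof.
move=> e_sym e_irr eca ecb ecd u.
set H : pred T := [in [:: c; a; b; d]]; set leaf : pred T := [in [:: a; b; d]].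
have leafH x : leaf x -> H x by rewrite /leaf /H /= [in X in _ -> X]inE => ->; rewrite orbT.
have Hc : H c by rewrite /H /= inE eqxx.
have ec x : leaf x -> e c x by rewrite /leaf /= !inE => /or3P[] /eqP ->.
have leafNc x : leaf x -> x != c.
  by move=> /ec; apply: contraTneq => ->; rewrite e_irr.
have cl x : leaf x -> induced e H c x by move=> lx; rewrite /induced ec // Hc leafH.
have lc x : leaf x -> induced e H x c by move=> lx; rewrite /induced e_sym ec // Hc leafH.
have HE x : H x -> x = c \/ leaf x by rewrite /H /= inE => /predU1P.
have toc x : H x -> connect (induced e H) x c.
  by move=> /HE[->|lx]; [exact: connect0 | apply: connect1; exact: lc].
have fromc x : H x -> connect (induced e H) c x.
  by move=> /HE[->|lx]; [exact: connect0 | apply: connect1; exact: cl].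
split=> [x y Hx Hy|x /HE[->|lx]|rs srs].
- exact: connect_trans (toc x Hx) (fromc y Hy).
- by exists a; apply: cl; rewrite /leaf /= inE eqxx.
- by exists c; exact: lc.
(* While T_R crosses the centre, T_S waits in a leaf that T_R avoids next. *)
pose ok y rs := leaf y && match rs with
  | r :: r' :: _ => (y != r) && ((r == c) ==> (y != r'))
  | [:: r] => y != r
  | [::] => true end.
have main y : ok y rs -> exists p, path (induced e H) y p /\ dodge rs (y :: p).
  elim: rs srs y => [|r rs IHrs] srs y oky; first by exists [::]; split=> //; exact: dodge0.
  have {}IHrs := IHrs (path_sorted srs).
  have ly : leaf y by case/andP: oky.
  have yr : y != r by move: oky; rewrite /ok; case: (rs) => [|r' s] /andP[_] // /andP[].
  have [z [okz rz]] : exists z, ok z rs /\ (z = y \/ [/\ r != c, z != r & leaf z]).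
    have [rc|rc] := eqVneq r c.
      exists y; split; last by left.
      move: oky srs; rewrite /ok rc ly /=; case: (rs) => [|r1 s] //=.
      rewrite eqxx /= => /andP[_ yr1] /andP[er1 _]; have r1c : r1 != c.
        by apply: contraTneq er1 => ->; rewrite e_irr.
      by case: s => [|r2 s]; rewrite ?yr1 // (negbTE r1c).
    (* With T_R off the centre, T_S can cross it to any leaf but [r]. It picks one that T_R does not
       visit next, or right after next if T_R is about to enter the centre. *)
    have [z [lz zr zr2]] : exists z, [/\ leaf z, z != r & ok z rs].
      case: (rs) => [|r1 [|r2 s]].
      - by have [z [lz zr _]] := third_element u r r; exists z; rewrite /ok /leaf lz zr.
      - have [z [lz zr zr1]] := third_element u r r1; exists z.
        by rewrite /ok /leaf /= lz zr zr1.
      have [r1c|r1c] := eqVneq r1 c.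
        have [z [lz zr zr2]] := third_element u r r2; exists z.
        by rewrite /ok /leaf /= lz zr r1c eqxx zr2 leafNc.
      have [z [lz zr zr1]] := third_element u r r1; exists z.
      by rewrite /ok /leaf /= lz zr zr1 (negbTE r1c).
    by exists z; split=> //; right.
  have [p [pp dd]] := IHrs z okz.
  case: rz => [zy|[rc zr lz]].
    move: pp dd; rewrite zy => pp dd; exists p; split=> //.
    by apply: (@dodgeS _ r rs [::]) => //; rewrite inE eq_sym.
  exists [:: c, z & p]; split; first by rewrite /= lc // cl.
  apply: (@dodgeS _ r rs [:: y; c]) => //.
  by rewrite !inE !negb_or rc !(eq_sym r) yr zr.
have [y oky] : exists y, ok y rs.
  case: (rs) => [|r [|r' s]].
  - by have [y [ly _ _]] := third_element u a a; exists y; rewrite /ok /leaf ly.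
  - by have [y [ly yr _]] := third_element u r r; exists y; rewrite /ok /leaf /= ly.
  have [y [ly yr yr']] := third_element u r r'.
  by exists y; rewrite /ok /leaf /= ly yr yr' implybT.
have [p [pp dd]] := main y oky.
by exists y, p; split=> //; apply: leafH; case/andP: oky.
Qed.

(** * Measurability of success and recurrence of the random walk *)

Section Borel.
Context {K : realType} {T : finType} (e : rel T).
Context {d : measure_display} {Omega : measurableType d}.
Variables (P : probability Omega K) (X : nat -> Omega -> T).
Hypothesis rwX : random_walk e P X.

Lemma measurable_forall (Q : nat -> Omega -> Prop) :
  (forall n, measurable [set o | Q n o]) -> measurable [set o | forall n, Q n o].
Proof.
move=> mQ; rewrite (_ : mkset _ = \bigcap_n [set o | Q n o]).
  exact: bigcapT_measurable.
by apply/seteqP; split=> o /= H n; [move=> _|apply: H].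
Qed.

Lemma measurable_exists (Q : nat -> Omega -> Prop) :
  (forall n, measurable [set o | Q n o]) -> measurable [set o | exists n, Q n o].
Proof.
move=> mQ; rewrite (_ : mkset _ = \bigcup_n [set o | Q n o]).
  exact: bigcupT_measurable.
by apply/seteqP; split=> o /= [n]; [exists n|move=> _; exists n].
Qed.

Lemma measurable_and (Q1 Q2 : Omega -> Prop) :
  measurable [set o | Q1 o] -> measurable [set o | Q2 o] -> measurable [set o | Q1 o /\ Q2 o].
Proof. exact: measurableI. Qed.

Lemma measurable_prefix n (Q : (nat -> T) -> Prop) :
  (forall R R', (forall t, (t <= n)%N -> R t = R' t) -> Q R -> Q R') ->
  measurable [set o | Q (X^~ o)].
Proof.
move=> ext.
rewrite (_ : mkset _ = \bigcup_(w in [set w : n.+1.-tuple T | exists2 R, hist R n = w & Q R])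
     [set o | hist (X^~ o) n = w]).
  apply: fin_bigcup_measurable => [|w _]; first exact: finite_finset.
  exact: measurable_hist rwX _ _.
apply/seteqP; split=> o /=.
  move=> Qo; have sz : size (hist (X^~ o) n) == n.+1 by rewrite size_hist.
  by exists (Tuple sz) => //=; exists (X^~ o).
move=> [w [R Rw QR] ow]; apply: (ext R) => //; apply/hist_eq; by rewrite Rw ow.
Qed.

Lemma measurable_reach S a b i j :
  measurable [set o | reach (advance a (X^~ o)) (advance b S) i j].
Proof.
apply: (@measurable_prefix (a + i) (fun R => reach (advance a R) (advance b S) i j)).
by move=> R R' RR' r; apply: (reach_ext r) => t ti; apply: RR'; rewrite leq_add2l.
Qed.

Lemma measurable_criterion S a b :
  measurable [set o | criterion (advance a (X^~ o)) (advance b S)].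
Proof.
apply: measurable_forall => J; apply: measurable_exists => i; apply: measurable_exists => j.
rewrite (_ : mkset _ = if (J <= j)%N then
    [set o | reach (advance a (X^~ o)) (advance b S) i j /\
      forall k, exists l, reach (advance (a + i.+1) (X^~ o)) (advance (b + j) S) k l]
    else set0).
  case: ifP => // _; apply: measurable_and; first exact: measurable_reach.
  by apply: measurable_forall => k; apply: measurable_exists => l; exact: measurable_reach.
apply/seteqP; split=> o /=.
  by move=> [-> r al] /=; split=> // k; have [l] := al k; rewrite !advance_advance; exists l.
case: ifP => //= Jj [r al]; split=> // k; have [l] := al k; exists l.
by rewrite !advance_advance.
Qed.

End Borel.

Section Recurrence.
Context {K : realType} {T : finType} (e : rel T).
Hypothesis deg_gt0 : forall x, (0 < #|e x|)%N.
Hypothesis e_connected : forall x y : T, connect e x y.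
Context {d : measure_display} {Omega : measurableType d}.
Variables (P : probability Omega K) (X : nat -> Omega -> T).
Hypothesis rwX : random_walk e P X.

Lemma measurable_avoid v m : measurable [set o | forall i, (m <= i)%N -> X i o <> v].
Proof.
apply: measurable_forall => i.
apply: (measurable_prefix rwX (n := i) (Q := fun R => (m <= i)%N -> R i <> v)).
by move=> R R' RR' av mi; rewrite -RR' //; exact: av.
Qed.

(** From any history, a path of length between [m] and [m + #|T|] ends at [v]; it is followed with
    probability bounded below. *)
Lemma prob_avoid v m : P [set o | forall i, (m <= i)%N -> X i o <> v] = 0%E.
Proof.
pose A w := exists R n, hist R n = w /\ forall i, (m <= i <= n)%N -> R i <> v.
have T0 : (0 < #|T|)%N by apply/card_gt0P; exists v.
apply: (prob_keep0 deg_gt0 rwX (measurable_avoid v m) (A := A) _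
   (c := (#|T|%:R)^-1 ^+ (m + #|T|))).
- by move=> o av n; exists (X^~ o), n; split=> // i /andP[mi _]; exact: av.
- by rewrite exprn_gt0 // invr_gt0 ltr0n.
move=> w; exists (m + #|T|)%N; apply: keep_escape => //; first by rewrite addn_gt0 T0 orbT.
move=> x h _; have [q [pq lq /andP[mq qm]]] := long_path e_connected x v m deg_gt0.
exists q; split=> // -[R [n [hR av]]].
have hd : head x (catrev q (x :: h)) = last x q.
  by case/lastP: (q) => [|s z]; rewrite ?last_rcons // catrevE rev_rcons.
have Rn : R n = v by rewrite -lq -hd -hR; case: (n).
apply: (av n _ Rn); rewrite leqnn andbT (leq_trans mq) //.
by have := size_hist R n; rewrite hR catrevE size_cat size_rev /=; lia.
Qed.

End Recurrence.

Section EvasiveOnDodgingGround.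
Context {K : realType} {T : finType} (e : rel T).
Hypothesis deg_gt0 : forall x, (0 < #|e x|)%N.
Hypothesis e_connected : forall x y : T, connect e x y.
Variables (H : pred T) (x0 v : T).
Hypotheses (Hx0 : H x0) (Hv : ~~ H v).
Hypothesis HD : dodging_ground e H.

Definition universal (S : nat -> T) : Prop :=
  forall y p, H y -> path (induced e H) y p -> forall J, exists2 j, (J <= j)%N &
    forall t, (t < size (y :: p))%N -> S (j + t)%N = nth x0 (y :: p) t.

Lemma universal_advance S k : universal S -> universal (advance k S).
Proof.
move=> uS y p Hy pp J; have [j kj Sj] := uS y p Hy pp (k + J)%N.
exists (j - k)%N; first by rewrite leq_subRL // (leq_trans (leq_addr _ _) kj).
move=> t tp; rewrite /advance addnA subnKC ?Sj //.
exact: leq_trans (leq_addr _ _) kj.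
Qed.

Variable S : nat -> T.
Hypothesis SH : forall j, H (S j).
Hypothesis uS : universal S.

Lemma successful_outside R i j : is_walk e R -> reach R S i j -> ~~ H (R i) ->
  (forall n, exists2 k, (n <= k)%N & ~~ H (R k)) -> successful R S.
Proof.
move=> wR r Ri out; apply: (successful_glue r).
apply: (@successful_escapes _ H) => //; rewrite /advance ?addn0 //.
- by move=> n; have [k nk Rk] := out (i + n)%N; exists (k - i)%N; rewrite ?subnKC //; lia.
move=> rs n Rrs J.
have srs : sorted e rs.
  apply/(sortedP (R i)) => t trs.
  have E s : (s < size rs)%N -> nth (R i) rs s = R (i + (n + s))%N.
    by move=> srs; rewrite Rrs // addn0.
  by rewrite !E ?(ltnW trs) // !addnS.
have [_ _ /(_ rs srs)[y [p [Hy pp dd]]]] := HD.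
have [k Jk Sk] := universal_advance j uS Hy pp J.
exists k => //; exists (y :: p) => // t tp; rewrite [LHS]Sk //.
by apply: set_nth_default.
Qed.

Lemma hits_every x : H x -> forall J, exists2 t, (J <= t)%N & S t = x.
Proof.
move=> Hx J; have [j Jj Sj] := @uS x [::] Hx isT J.
by exists j => //; have := Sj 0%N isT; rewrite addn0.
Qed.

(** If R is outside [H] infinitely often, reaching a single such vertex suffices. Otherwise R ends
    up in [H], where S visits every vertex infinitely often, and [criterion] decides. The right-hand
    side is built by countable operations from events on finite prefixes, hence measurable. *)
Lemma successful_iff R : is_walk e R -> successful R S <->
  ((forall n, exists k, (n <= k)%N /\ ~~ H (R k)) /\
     (exists i j, ~~ H (R i) /\ reach R S i j)) \/
  (exists m, (forall k, (m <= k)%N -> H (R k)) /\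
     exists l, reach R S m l /\ criterion (advance m.+1 R) (advance l S)).
Proof.
move=> wR; split=> [suc|].
  have [out|nout] := pselect (forall n, exists k, (n <= k)%N /\ ~~ H (R k)); [left|right].
    split=> //; have [i [_ Ri]] := out 0%N.
    by have [j r] := successful_reachR suc i; exists i, j.
  have /existsNP[m nm] := nout; exists m; split.
    by move=> k mk; apply: contrapT => /negP Rk; apply: nm; exists k.
  have [l r suc'] := successful_cut m suc; exists l; split=> //.
  exact: successful_criterion.
case=> [[out [i [j [Ri r]]]]|[m [Rm [l [r crit]]]]].
  by apply: (successful_outside wR r Ri) => n; have [k [nk Rk]] := out n; exists k.
apply: (successful_glue_exit r); apply: criterion_successful crit => i J.
have [|t lt St] := @hits_every (R (m.+1 + i)%N) _ (l + J)%N.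
  by apply: Rm; rewrite addSnnS leq_addr.
by exists (t - l)%N; rewrite /advance ?subnKC ?St //; lia.
Qed.

Lemma evasive_universal : is_walk e S -> evasive K e S.
Proof.
move=> wS; split=> // d Omega P X rwX E.
have [wX mX X0 _] := rwX.
have mH i (b : bool) : measurable [set o | H (X i o) = b].
  apply: (measurable_prefix rwX (n := i) (Q := fun R => H (R i) = b)).
  by move=> R R' RR'; rewrite RR'.
have mE : measurable E.
  rewrite (_ : E = [set o | (forall n, exists k, (n <= k)%N /\ ~~ H (X k o)) /\
       (exists i j, ~~ H (X i o) /\ reach (X^~ o) S i j)] `|`
    [set o | exists m, (forall k, (m <= k)%N -> H (X k o)) /\
       exists l, reach (X^~ o) S m l /\ criterion (advance m.+1 (X^~ o)) (advance l S)]).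
    apply: measurableU.
      apply: measurable_and.
        apply: measurable_forall => n; apply: measurable_exists => k.
        apply: (measurable_prefix rwX (n := k) (Q := fun R => (n <= k)%N /\ ~~ H (R k))).
        by move=> R R' RR'; rewrite RR'.
      apply: measurable_exists => i; apply: measurable_exists => j; apply: measurable_and.
        by apply: (measurable_prefix rwX (n := i) (Q := fun R => ~~ H (R i))) => R R' RR';
          rewrite RR'.
      exact: (measurable_reach rwX S 0 0).
    apply: measurable_exists => m; apply: measurable_and.
      apply: measurable_forall => k.
      apply: (measurable_prefix rwX (n := k) (Q := fun R => (m <= k)%N -> H (R k))).
      by move=> R R' RR'; rewrite RR'.
    apply: measurable_exists => l; apply: measurable_and.
      exact: (measurable_reach rwX S 0 0).
    exact: (measurable_criterion rwX).
  by apply/seteqP; split=> o /=; [move/(successful_iff (wX o)) | move=> ?; apply/(successful_iff (wX o))].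
split=> //; rewrite lt_neqAle measure_ge0 andbT eq_sym; apply/negP => /eqP PE0.
(* A walk starting at [v] succeeds unless it eventually avoids [v], a null event. So null success
   would make the start at [v] null, against its probability [1 / #|T|]. *)
have neg : P.-negligible (X 0%N @^-1` [set v]).
  apply: (@negligibleS _ _ _ P
      (E `|` \bigcup_m [set o | forall i, (m <= i)%N -> X i o <> v])).
    move=> o /= Xv; have [out|] := pselect (forall n, exists k, (n <= k)%N /\ ~~ H (X k o)).
      left; have r0 : reach (X^~ o) S 0 0.
        by apply: reach0; rewrite Xv => vS; move: Hv; rewrite vS SH.
      apply: (successful_outside (wX o) r0); first by rewrite Xv.
      by move=> n; have [k [nk Xk]] := out n; exists k.
    move=> /existsNP[n nn]; right; exists n => // i ni Xi.
    by apply: nn; exists i; rewrite Xi.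
  apply: negligibleU; first by apply/negligibleP.
  apply: negligible_bigcup => m; apply/negligibleP; first exact: measurable_avoid rwX v m.
  exact: prob_avoid.
have := X0 v; rewrite (_ : P _ = 0%E); last by apply/negligibleP.
move=> /eqP; rewrite eqe eq_sym invr_eq0 pnatr_eq0.
by apply/negP; rewrite -lt0n; apply/card_gt0P; exists v.
Qed.

End EvasiveOnDodgingGround.

Lemma dodging_evasive (K : realType) (T : finType) (e : rel T) (H : pred T) (x0 v : T) :
  (forall x, (0 < #|e x|)%N) -> (forall x y : T, connect e x y) ->
  H x0 -> ~~ H v -> dodging_ground e H -> exists S, evasive K e S.
Proof.
move=> deg_gt0 conn Hx0 Hv HD; have [cH nH _] := HD.
have [|S [S0 wS uS]] := universal_walk Hx0 cH nH; first by move=> x y /and3P[].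
exists S; apply: (evasive_universal deg_gt0 conn Hx0 Hv HD) => //.
- by move=> j; have /and3P[] := wS j.
- by move=> i; have /and3P[] := wS i.
Qed.

(** One edge excludes the one-vertex graph, the only connected graph with an isolated vertex. *)
Lemma connected_deg_gt0 (T : finType) (e : rel T) (x y : T) :
  (forall x y : T, connect e x y) -> e x y -> forall z, (0 < #|e z|)%N.
Proof.
move=> conn exy z; apply/card_gt0P; have /connectP[[|t p] /= pz lz] := conn z x.
  by exists y; rewrite -lz.
by exists t; case/andP: pz.
Qed.

Theorem theorem1p3 (K : realType) (T : finType) (e : rel T)
    (e_sym : symmetric e) (e_irr : irreflexive e)
    (T_nonempty : (0 < #|T|)%N)
    (e_connected : forall x y : T, connect e x y) :
  (exists S : nat -> T, evasive K e S) <->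
  [/\ ~ is_path_graph e, ~ is_cycle_graph e & ~ is_claw_graph e].
Proof.
split=> [[S ev]|[NP NC Nclaw]].
  have deg_gt0 := connected_deg_gt0 e_connected (ev.1 0%N).
  split=> G; [exact: path_not_evasive G ev | exact: cycle_not_evasive G ev
             | exact: claw_not_evasive G ev].
have /card_gt0P[x0 _] := T_nonempty.
have [[c [a [b [d [v [ca cb cd u vN]]]]]]|[a [b [c [v [ab bc ca vN]]]]]] :=
  claw_or_triangle x0 e_sym e_irr e_connected NP NC Nclaw.
  apply: (@dodging_evasive K T e [in [:: c; a; b; d]] c v) => //.
  - exact: connected_deg_gt0 e_connected ca.
  - by rewrite inE eqxx.
  - exact: claw_dodging.
apply: (@dodging_evasive K T e [in [:: a; b; c]] a v) => //.
- exact: connected_deg_gt0 e_connected ab.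
- by rewrite inE eqxx.
- exact: triangle_dodging.
Qed.
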